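(* Let $\mathfrak{g} = \mathfrak{sl}_n(\mathbb{C})$, let $\mu$ and $\lambda$ be partitions of $n$ such that $\lambda$ covers $\mu$ in the dominance ordering, and let $e_1, e_2, \mathfrak{m}_1, \mathfrak{m}_2, \mathfrak{k}, \chi_1, \chi_2, \kappa$ be constructed from the right-aligned pyramid of $\mu$ as described in the context. Then $e_2$ is a nilpotent element of Jordan type $\lambda$, $\mathfrak{m}_2$ is a Lie algebra, and the following hold: (1) $\mathfrak{m}_2$ decomposes as a semidirect product $\mathfrak{m}_2 = \mathfrak{m}_1 \rtimes \mathfrak{k}$; (2) $\chi_2$ restricts to a character of $\mathfrak{m}_2$, and $\chi_2 = (\chi_1, \kappa)$ in the decomposition $\mathfrak{m}_2 = \mathfrak{m}_1 \rtimes \mathfrak{k}$ (i.e. $\chi_2|_{\mathfrak{m}_1} = \chi_1|_{\mathfrak{m}_1}$ and $\chi_2|_{\mathfrak{k}} = \kappa$); (3) the subalgebra $\mathfrak{k}$ annihilates $\chi_1$ (under the co-adjoint action). Consequently there is a homomorphism of algebras from the quantum Hamiltonian reduction by stages to the one-shot reduction: $$\bigl(U(\mathfrak{g}) /\!/\!/_{\chi_1} \mathfrak{m}_1\bigr) /\!/\!/_{\kappa}\, \mathfrak{k} = U(\mathfrak{g},e_1) /\!/\!/_{\kappa}\, \mathfrak{k} \longrightarrow U(\mathfrak{g}) /\!/\!/_{\chi_2} \mathfrak{m}_2 .$$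
   Context: Quantum Hamiltonian reduction. For a nilpotent subalgebra $\mathfrak{m}\subseteq\mathfrak{g}$ and $\chi \in \mathfrak{g}^*$ restricting to a character of $\mathfrak{m}$, put $\mathfrak{m}_\chi = \{y - \chi(y) : y \in \mathfrak{m}\} \subseteq U(\mathfrak{g})$ and $$U(\mathfrak{g}) /\!/\!/_\chi \mathfrak{m} := \bigl(U(\mathfrak{g})/U(\mathfrak{g})\mathfrak{m}_\chi\bigr)^{\mathfrak{m}} = \{\bar u : [a,u] \in U(\mathfrak{g})\mathfrak{m}_\chi \ \forall a \in \mathfrak{m}\},$$ an algebra with product induced from $U(\mathfrak{g})$. Construction. Partitions are padded with zeros. Since $\lambda$ covers $\mu$ in the dominance ordering, there are indices $i<j$ with $\lambda_i = \mu_i+1$, $\lambda_j = \mu_j - 1$ and $\lambda_s = \mu_s$ otherwise. Take the right-aligned pyramid of shape $\mu$: rows are numbered from the bottom, row $r$ consists of $\mu_r$ consecutive boxes, all rows have their rightmost box in the same column, and horizontally adjacent boxes have column coordinates differing by $2$ (increasing to the right). Label the boxes $1,\dots,n$ from bottom to top within each column, columns being taken from left to right. Let $\mathrm{row}(k)$, $\mathrm{col}(k)$ be the row and column of box $k$; write $k \to \ell$ if $\mathrm{row}(k) = \mathrm{row}(\ell)$ and $\mathrm{col}(\ell) = \mathrm{col}(k)+2$. Let $E_{k\ell}$ be the matrix units. Set $e_1 = \sum_{k\to\ell} E_{k\ell}$ (nilpotent of type $\mu$), grade $\mathfrak{g}$ by $\deg E_{k\ell} = \mathrm{col}(\ell)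 - \mathrm{col}(k)$ (an even good grading for $e_1$), and let $\mathfrak{m}_1 = \bigoplus_{d \le -2} \mathfrak{g}_d$. Define $$e_2 = e_1 + \sum_{\substack{\mathrm{row}(k)=i,\ \mathrm{row}(\ell)=j\\ \mathrm{col}(k)=\mathrm{col}(\ell)}} E_{k\ell}, \qquad E_m = \sum_{\substack{i \le \mathrm{row}(k) < \mathrm{row}(\ell) \le j\\ \mathrm{row}(\ell)-\mathrm{row}(k) = m\\ \mathrm{col}(k)=\mathrm{col}(\ell)}} E_{\ell k}\quad (1 \le m \le j-i),$$ $\mathfrak{k} = \langle E_m \rangle_{m=1}^{j-i}$ and $\mathfrak{m}_2 = \mathfrak{m}_1 + \mathfrak{k}$. Let $\chi_a = \langle e_a, \cdot\rangle \in \mathfrak{g}^*$ for $a=1,2$, where $\langle\cdot,\cdot\rangle$ is the Killing form, and $\kappa = \chi_2|_{\mathfrak{k}}$. The W-algebra of $e_1$ is $U(\mathfrak{g},e_1) = U(\mathfrak{g})/\!/\!/_{\chi_1}\mathfrak{m}_1$. The Lie algebra $\mathfrak{k}$ acts on it by the adjoint action, with comoment map sending $y\in\mathfrak{k}$ to its class $\bar y$; with $\mathfrak{k}_\kappa = \{\bar y - \kappa(y) : y \in \mathfrak{k}\}$ one sets $U(\mathfrak{g},e_1)/\!/\!/_\kappa \mathfrak{k} := (U(\mathfrak{g},e_1)/U(\mathfrak{g},e_1)\mathfrak{k}_\kappa)^{\mathfrak{k}}$. The homomorphism in the claim is the reduction-by-stages map induced by the identity on representatives: the class of $a + U(\mathfrak{g})\mathfrak{m}_{1,\chi_1}$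 is sent to $a + U(\mathfrak{g})\mathfrak{m}_{2,\chi_2}$. *)

(* Defs.v *)
From HB Require Import structures.
From mathcomp Require Import all_boot all_order all_algebra.
From mathcomp Require Import generic_quotient ring_quotient.
From mathcomp Require Import boolp ring.
From mathcomp.multinomials Require monalg.

Set Implicit Arguments.
Unset Strict Implicit.
Unset Printing Implicit Defensive.

Import Order.TTheory GRing.Theory Num.Theory.
Local Open Scope ring_scope.
Local Open Scope quotient_scope.

(* Unital associative K-algebras, given by their structure map from K to the  *)
(* centre. GRing.Algebra is not used because it requires 1 != 0, which a      *)
(* Hamiltonian reduction of an arbitrary algebra need not satisfy.            *)
HB.mixin Record isPzAlgebra (K : fieldType) A of GRing.PzRing A := {
  scal : K -> A;
  scal_zmod : zmod_morphism scal;
  scal_monoid : monoid_morphism scal;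
  scal_central : forall (a : K) (x : A), scal a * x = x * scal a
}.

#[short(type="pzAlgType")]
HB.structure Definition PzAlgebra (K : fieldType) :=
  { A of GRing.PzRing A & isPzAlgebra K A }.

Definition is_alg_hom (K : fieldType) (A B : pzAlgType K)
    (f : {rmorphism A -> B}) :=
  forall a : K, f (scal a) = scal a.

HB.mixin Record isLieAlgebra (K : fieldType) L of Vector K L := {
  lieb : L -> L -> L;
  lieb_linearl : forall y, linear (lieb^~ y);
  lieb_linearr : forall x, linear (lieb x);
  liebxx : forall x, lieb x x = 0;
  lieb_jacobi : forall x y z,
    lieb x (lieb y z) + lieb y (lieb z x) + lieb z (lieb x y) = 0
}.

#[short(type="lieAlgType")]
HB.structure Definition LieAlgebra (K : fieldType) :=
  { L of Vector K L & isLieAlgebra K L }.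

Section LeftIdeal.
Variables (A : pzRingType) (S : A -> Prop).

Definition lideal : {pred A} := fun u =>
  `[< exists r : seq (A * A),
        (forall p, p \in r -> S p.2) /\ u = \sum_(p <- r) p.1 * p.2 >].

Lemma lidealP u :
  reflect (exists r : seq (A * A),
             (forall p, p \in r -> S p.2) /\ u = \sum_(p <- r) p.1 * p.2)
          (u \in lideal).
Proof. exact: asboolP. Qed.

Lemma lideal_gen s : S s -> s \in lideal.
Proof.
move=> Ss; apply/lidealP; exists [:: (1, s)]; split; last by rewrite big_seq1 mul1r.
by move=> p; rewrite inE => /eqP->.
Qed.

Lemma lidealM x u : u \in lideal -> x * u \in lideal.
Proof.
move=> /lidealP[r [Sr ->]]; apply/lidealP.
exists [seq (x * p.1, p.2) | p <- r]; split.
  by move=> _ /mapP[p pr ->] /=; exact: Sr pr.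
by rewrite big_map mulr_sumr; apply: eq_bigr => p _; rewrite mulrA.
Qed.

Lemma lideal_zmod_closed : zmod_closed lideal.
Proof.
have addI u v : u \in lideal -> v \in lideal -> u + v \in lideal.
  move=> /lidealP[r [Sr ->]] /lidealP[s [Ss ->]]; apply/lidealP.
  exists (r ++ s); split; last by rewrite big_cat.
  by move=> p; rewrite mem_cat => /orP[/Sr|/Ss].
split=> [|u v Iu Iv]; first by apply/lidealP; exists [::]; rewrite big_nil.
by apply: addI => //; rewrite -mulN1r lidealM.
Qed.

HB.instance Definition _ := GRing.isZmodClosed.Build A lideal lideal_zmod_closed.

Lemma lideal_mulr v : (forall s, S s -> s * v \in lideal) ->
  forall u, u \in lideal -> u * v \in lideal.
Proof.
move=> Sv u /lidealP[r [Sr ->]]; rewrite mulr_suml big_seq rpred_sum // => p pr.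
by rewrite -mulrA lidealM //; apply/Sv/Sr.
Qed.

Definition lquot := Quotient.quot lideal.
HB.instance Definition _ := GRing.Zmodule.on lquot.

Definition lclass (u : A) : lquot := \pi u.

Lemma lclass_eq u v : (lclass u = lclass v) <-> (u - v \in lideal).
Proof.
by rewrite (Quotient.idealrBE lideal u v); split=> /eqP.
Qed.

Lemma lclass_repr (x : lquot) : lclass (repr x) = x.
Proof. exact: reprK. Qed.

Lemma lclassP (x : lquot) : exists u, x = lclass u.
Proof. by exists (repr x); rewrite lclass_repr. Qed.

Lemma lclass_is_zmod_morphism : zmod_morphism lclass.
Proof. by move=> u v; rewrite /lclass raddfB. Qed.
HB.instance Definition _ :=
  GRing.isZmodMorphism.Build A lquot lclass lclass_is_zmod_morphism.

Lemma lclassM u v u' v' : lclass u = lclass u' -> lclass v = lclass v' ->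
  (forall d, d \in lideal -> d * v \in lideal) ->
  lclass (u * v) = lclass (u' * v').
Proof.
move=> /lclass_eq uu' /lclass_eq vv' Iv; apply/lclass_eq.
rewrite (_ : _ - _ = (u - u') * v + u' * (v - v')); last first.
  by rewrite mulrBl mulrBr addrA addrNK.
by apply: rpredD; [apply: Iv | apply: lidealM].
Qed.

End LeftIdeal.

(* The free associative algebra on X: the monoid algebra of words in X.       *)
Section FreeAlgebra.
Import monalg.
Variables (K : fieldType) (X : choiceType).

Definition freealg := malg (fmonom X) K.
HB.instance Definition _ := GRing.NzRing.on freealg.

Definition freegen (x : X) : freealg := mkmalgU (fmu x) 1.

Definition freescal (a : K) : freealg := malgC a.

Lemma freescal_zmod : zmod_morphism freescal.
Proof. by move=> a b; rewrite /freescal raddfB. Qed.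
Lemma freescal_monoid : monoid_morphism freescal.
Proof.
by split=> [|a b]; rewrite /freescal ?mpolyC1E // (@mpolyCM (fmonom X) K).
Qed.
Lemma freescal_central a (x : freealg) : freescal a * x = x * freescal a.
Proof.
rewrite /freescal; transitivity (fgmul (malgC a) x); first by [].
transitivity (fgmul x (malgC a)); last by [].
rewrite fgmulUg fgmulgU; apply: eq_bigr => k _.
by rewrite mul1m mulm1 mulrC.
Qed.

HB.instance Definition _ := isPzAlgebra.Build K freealg
  freescal_zmod freescal_monoid freescal_central.
End FreeAlgebra.

(* The quotient of an algebra by the two-sided ideal generated by R, which is *)
(* the left ideal generated by the products r * b with r in R.                *)
Section AlgebraQuotient.
Variables (K : fieldType) (A : pzAlgType K) (R : A -> Prop).

Definition algquot_gen (u : A) : Prop := exists2 r, R r & exists b, u = r * b.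

Definition algquot := lquot algquot_gen.
HB.instance Definition _ := GRing.Zmodule.on algquot.

Definition algclass (u : A) : algquot := lclass algquot_gen u.

Lemma algclassP (x : algquot) : exists u, x = algclass u.
Proof. exact: lclassP. Qed.
Lemma algclassD u v : algclass (u + v) = algclass u + algclass v.
Proof. exact: raddfD. Qed.
Lemma algclassB u v : algclass (u - v) = algclass u - algclass v.
Proof. exact: raddfB. Qed.

Lemma algquot_idealMr d v :
  d \in lideal algquot_gen -> d * v \in lideal algquot_gen.
Proof.
apply: lideal_mulr => _ [r Rr [b ->]]; apply: lideal_gen.
by exists r => //; exists (b * v); rewrite mulrA.
Qed.

Definition algquot_mul (x y : algquot) : algquot := algclass (repr x * repr y).

Lemma algquot_mulE u v : algquot_mul (algclass u) (algclass v) = algclass (u * v).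
Proof.
by apply: lclassM; rewrite ?lclass_repr // => d; apply: algquot_idealMr.
Qed.

Lemma algquot_mulA : associative algquot_mul.
Proof.
move=> x y z; have [u ->] := algclassP x; have [v ->] := algclassP y.
have [w ->] := algclassP z.
rewrite (algquot_mulE v w) (algquot_mulE u v) (algquot_mulE u).
by rewrite (algquot_mulE _ w) mulrA.
Qed.
Lemma algquot_mul1 : left_id (algclass 1) algquot_mul.
Proof.
by move=> x; have [u ->] := algclassP x; rewrite (algquot_mulE 1 u) mul1r.
Qed.
Lemma algquot_mulr1 : right_id (algclass 1) algquot_mul.
Proof.
by move=> x; have [u ->] := algclassP x; rewrite (algquot_mulE u 1) mulr1.
Qed.
Lemma algquot_mulDl : left_distributive algquot_mul +%R.
Proof.
move=> x y z; have [u ->] := algclassP x; have [v ->] := algclassP y.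
have [w ->] := algclassP z.
rewrite (algquot_mulE u w) (algquot_mulE v w) -(algclassD u v).
by rewrite (algquot_mulE _ w) mulrDl algclassD.
Qed.
Lemma algquot_mulDr : right_distributive algquot_mul +%R.
Proof.
move=> x y z; have [u ->] := algclassP x; have [v ->] := algclassP y.
have [w ->] := algclassP z.
rewrite (algquot_mulE u v) (algquot_mulE u w) -(algclassD v w).
by rewrite (algquot_mulE u) mulrDr algclassD.
Qed.
HB.instance Definition _ := GRing.Zmodule_isPzRing.Build algquot
  algquot_mulA algquot_mul1 algquot_mulr1 algquot_mulDl algquot_mulDr.

Lemma algclassM u v : algclass (u * v) = algclass u * algclass v.
Proof. exact/esym/algquot_mulE. Qed.

Definition algquot_scal (a : K) : algquot := algclass (scal a).
Lemma algquot_scal_zmod : zmod_morphism algquot_scal.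
Proof. by move=> a b; rewrite /algquot_scal scal_zmod algclassB. Qed.
Lemma algquot_scal_monoid : monoid_morphism algquot_scal.
Proof.
have [s1 sM] := @scal_monoid K A; split=> [|a b].
  by rewrite /algquot_scal s1.
by rewrite /algquot_scal sM algclassM.
Qed.
Lemma algquot_scal_central a (x : algquot) :
  algquot_scal a * x = x * algquot_scal a.
Proof.
have [u ->] := algclassP x.
by rewrite /algquot_scal -!algclassM scal_central.
Qed.
HB.instance Definition _ := isPzAlgebra.Build K algquot
  algquot_scal_zmod algquot_scal_monoid algquot_scal_central.

Lemma algclass_rel r s : R (r - s) -> algclass r = algclass s.
Proof.
move=> Rrs; apply/lclass_eq/lideal_gen.
by exists (r - s) => //; exists 1; rewrite mulr1.
Qed.

End AlgebraQuotient.

(* U(L) is presented by generators <x>, for x in L, subject to the linearity  *)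
(* of x |-> <x> and to <x><y> - <y><x> = <[x, y]>.                            *)
Section UniversalEnvelopingAlgebra.
Variables (K : fieldType) (L : lieAlgType K).
Let g : L -> freealg K L := @freegen K L.

Inductive uea_relation : freealg K L -> Prop :=
| UeaAdd x y : uea_relation (g (x + y) - (g x + g y))
| UeaScale a x : uea_relation (g (a *: x) - scal a * g x)
| UeaBracket x y : uea_relation (g (lieb x y) - (g x * g y - g y * g x)).

Definition uea := algquot uea_relation.
HB.instance Definition _ := PzAlgebra.on uea.

Definition uea_in (x : L) : uea := algclass uea_relation (g x).

Lemma uea_inD x y : uea_in (x + y) = uea_in x + uea_in y.
Proof. by rewrite -algclassD; apply/algclass_rel/UeaAdd. Qed.
Lemma uea_inZ a x : uea_in (a *: x) = scal a * uea_in x.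
Proof. by rewrite -algclassM; apply/algclass_rel/UeaScale. Qed.
Lemma uea_in_lieb x y :
  uea_in (lieb x y) = uea_in x * uea_in y - uea_in y * uea_in x.
Proof. by rewrite -!algclassM -algclassB; apply/algclass_rel/UeaBracket. Qed.

End UniversalEnvelopingAlgebra.

(* Quantum Hamiltonian reduction (A / A.m_chi)^m of an algebra A along a      *)
(* comoment map theta : m -> A at chi : m -> K. No condition on theta and chi *)
(* is needed for the product of A to descend to these invariants.             *)
Section QuantumHamiltonianReduction.
Variables (K : fieldType) (A : pzAlgType K) (m : Type).
Variables (theta : m -> A) (chi : m -> K).

Definition shifted (a : A) : Prop := exists y : m, a = theta y - scal (chi y).

Definition qhr_invariant : {pred lquot shifted} := fun x =>
  `[< exists2 u : A, x = lclass shifted u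
      & forall y : m, theta y * u - u * theta y \in lideal shifted >].

Record qhr : predArgType :=
  QHR { qhr_val :> lquot shifted; _ : qhr_val \in qhr_invariant }.

HB.instance Definition _ := [isSub for qhr_val].
HB.instance Definition _ := [Choice of qhr by <:].

Let I := lideal shifted.
Let cls : A -> lquot shifted := lclass shifted.
Lemma qhr_classD u v : cls (u + v) = cls u + cls v.
Proof. exact: raddfD. Qed.
Lemma qhr_classB u v : cls (u - v) = cls u - cls v.
Proof. exact: raddfB. Qed.
Let normal (u : A) := forall y : m, theta y * u - u * theta y \in I.

Lemma qhr_invariantP x :
  reflect (exists2 u, x = cls u & normal u) (x \in qhr_invariant).
Proof. exact: asboolP. Qed.

Lemma qhr_invariant_zmod_closed : zmod_closed qhr_invariant.
Proof.
split=> [|x z /qhr_invariantP[u -> nu] /qhr_invariantP[v -> nv]];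
  apply/qhr_invariantP.
  by exists 0; first exact/esym/raddf0; move=> y; rewrite mulr0 mul0r subrr rpred0.
exists (u - v); first exact/esym/qhr_classB.
move=> y; rewrite (_ : _ - _ = (theta y * u - u * theta y)
                            - (theta y * v - v * theta y)); last first.
  rewrite mulrBr mulrBl !opprB [LHS]addrACA [RHS]addrACA; congr (_ + _).
  exact: addrC.
by apply: rpredB; [apply: nu | apply: nv].
Qed.
HB.instance Definition _ :=
  GRing.isZmodClosed.Build _ qhr_invariant qhr_invariant_zmod_closed.
HB.instance Definition _ := [SubChoice_isSubZmodule of qhr by <:].

Lemma qhrP (x : qhr) : exists2 u, qhr_val x = cls u & normal u.
Proof. exact/qhr_invariantP/(valP x). Qed.

Lemma normal_idealMr v : normal v -> forall d, d \in I -> d * v \in I.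
Proof.
move=> nv; apply: lideal_mulr => _ [y ->].
rewrite mulrBl scal_central -[theta y * v](subrK (v * theta y)) -addrA -mulrBr.
by rewrite rpredD ?lidealM ?nv //; apply: lideal_gen; exists y.
Qed.

Lemma normalM u v : normal u -> normal v -> normal (u * v).
Proof.
move=> nu nv y.
rewrite (_ : _ - _ = (theta y * u - u * theta y) * v
                     + u * (theta y * v - v * theta y)); last first.
  by rewrite mulrBl mulrBr !mulrA addrA addrNK.
by apply: rpredD; [apply: normal_idealMr | apply: lidealM].
Qed.

Lemma normal_scal a : normal (scal a).
Proof. by move=> y; rewrite scal_central subrr rpred0. Qed.

Lemma qhr_mul_subproof (x z : qhr) :
  cls (repr (qhr_val x) * repr (qhr_val z)) \in qhr_invariant.
Proof.
have [u xu nu] := qhrP x; have [v zv nv] := qhrP z.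
apply/qhr_invariantP; exists (u * v); last exact: normalM.
by apply/esym/lclassM; rewrite ?lclass_repr //; apply: normal_idealMr.
Qed.
Definition qhr_mul (x z : qhr) : qhr := QHR (qhr_mul_subproof x z).

Lemma qhr_mulE (x z : qhr) u v : qhr_val x = cls u -> qhr_val z = cls v ->
  qhr_val (qhr_mul x z) = cls (u * v).
Proof.
move=> xu zv; have [v' zv' nv'] := qhrP z.
have mulr : forall w w', cls w = qhr_val x -> cls w' = qhr_val z ->
    cls (w * w') = cls (u * v').
  move=> w w' xw zw; apply/esym/lclassM; rewrite -?/(cls _) ?xw ?zw -?xu -?zv' //.
  exact: normal_idealMr.
by rewrite [LHS]mulr ?mulr // /cls lclass_repr.
Qed.

Lemma qhr_scal_subproof a : cls (scal a) \in qhr_invariant.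
Proof. by apply/qhr_invariantP; exists (scal a) => //; apply: normal_scal. Qed.
Definition qhr_scal (a : K) : qhr := QHR (qhr_scal_subproof a).

Lemma qhr_inj : injective qhr_val.
Proof. exact: val_inj. Qed.
Lemma qhr_valD x y : qhr_val (x + y) = qhr_val x + qhr_val y.
Proof. by []. Qed.
Lemma qhr_mulA : associative qhr_mul.
Proof.
move=> x y z; have [u xu _] := qhrP x; have [v yv _] := qhrP y.
have [w zw _] := qhrP z; apply: qhr_inj.
rewrite (qhr_mulE xu (qhr_mulE yv zw)) (qhr_mulE (qhr_mulE xu yv) zw).
by rewrite mulrA.
Qed.
Lemma qhr_scal1 : scal 1 = 1 :> A. Proof. by case: (@scal_monoid K A). Qed.
Lemma qhr_mul1 : left_id (qhr_scal 1) qhr_mul.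
Proof.
move=> x; have [u xu _] := qhrP x; apply: qhr_inj.
by rewrite (@qhr_mulE (qhr_scal 1) _ 1 _ _ xu) /= ?qhr_scal1 ?mul1r.
Qed.
Lemma qhr_mulr1 : right_id (qhr_scal 1) qhr_mul.
Proof.
move=> x; have [u xu _] := qhrP x; apply: qhr_inj.
by rewrite (@qhr_mulE _ (qhr_scal 1) _ 1 xu) /= ?qhr_scal1 ?mulr1.
Qed.
Lemma qhr_mulDl : left_distributive qhr_mul +%R.
Proof.
move=> x y z; have [u xu _] := qhrP x; have [v yv _] := qhrP y.
have [w zw _] := qhrP z; apply: qhr_inj.
have xyuv : qhr_val (x + y) = cls (u + v).
  by rewrite qhr_valD xu yv -qhr_classD.
rewrite (qhr_mulE xyuv zw) mulrDl qhr_classD qhr_valD.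
by rewrite (qhr_mulE xu zw) (qhr_mulE yv zw).
Qed.
Lemma qhr_mulDr : right_distributive qhr_mul +%R.
Proof.
move=> x y z; have [u xu _] := qhrP x; have [v yv _] := qhrP y.
have [w zw _] := qhrP z; apply: qhr_inj.
have yzvw : qhr_val (y + z) = cls (v + w).
  by rewrite qhr_valD yv zw -qhr_classD.
rewrite (qhr_mulE xu yzvw) mulrDr qhr_classD qhr_valD.
by rewrite (qhr_mulE xu yv) (qhr_mulE xu zw).
Qed.
HB.instance Definition _ := GRing.Zmodule_isPzRing.Build qhr
  qhr_mulA qhr_mul1 qhr_mulr1 qhr_mulDl qhr_mulDr.

Lemma qhr_scal_zmod : zmod_morphism qhr_scal.
Proof.
by move=> a b; apply: qhr_inj; rewrite /= scal_zmod qhr_classB.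
Qed.
Lemma qhr_valM (x z : qhr) u v : qhr_val x = cls u -> qhr_val z = cls v ->
  qhr_val (x * z) = cls (u * v).
Proof. exact: qhr_mulE. Qed.
Lemma qhr_scal_monoid : monoid_morphism qhr_scal.
Proof.
have [s1 sM] := @scal_monoid K A; split=> // a b; apply: qhr_inj.
rewrite (@qhr_valM (qhr_scal a) (qhr_scal b) (scal a) (scal b)) //.
by rewrite -sM.
Qed.
Lemma qhr_scal_central a (x : qhr) : qhr_scal a * x = x * qhr_scal a.
Proof.
have [u xu _] := qhrP x; apply: qhr_inj.
rewrite (@qhr_valM (qhr_scal a) x (scal a) u) //.
by rewrite (@qhr_valM x (qhr_scal a) u (scal a)) // scal_central.
Qed.
HB.instance Definition _ := isPzAlgebra.Build K qhr
  qhr_scal_zmod qhr_scal_monoid qhr_scal_central.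

(* The class of a, provided that it is invariant.                             *)
Definition qhr_of (a : A) : qhr := insubd 0 (lclass shifted a).

End QuantumHamiltonianReduction.

Section LieTheory.
Variables (K : fieldType) (L : lieAlgType K).
Implicit Types (x y : L) (h k m : {vspace L}) (chi : 'Hom(L, K^o)).

Definition ad x : 'End(L) := linfun (lieb x).

Lemma adE x y : ad x y = lieb x y.
Proof.
pose f := GRing.isLinear.Build K L L *:%R (lieb x) (lieb_linearr x).
pose F : {linear L -> L} := HB.pack (lieb x) f.
exact: (lfunE F).
Qed.

Definition endo_trace (f : 'End(L)) : K :=
  \sum_i coord (vbasis {:L}) i (f (vbasis {:L})`_i).

Definition killing x y : K := endo_trace (ad x \o ad y)%VF.

Definition killing_dual x : 'Hom(L, K^o) := linfun (killing x : L -> K^o).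

Lemma killing_dualE x y : killing_dual x y = killing x y.
Proof.
have lin : linear (killing x : L -> K^o).
  move=> a u v; rewrite /killing /endo_trace scaler_sumr -big_split /=.
  apply: eq_bigr => i _; rewrite !comp_lfunE !adE.
  have [f g] := (lieb_linearl (vbasis {:L})`_i a u v, lieb_linearr x).
  by rewrite f g linearP.
pose f := GRing.isLinear.Build K L K^o *:%R (killing x : L -> K^o) lin.
pose F : {linear L -> K^o} := HB.pack (killing x : L -> K^o) f.
exact: (lfunE F).
Qed.

Definition coad y chi : 'Hom(L, K^o) := - (chi \o ad y)%VF.

Definition lie_subalgebra m := {in m &, forall x y, lieb x y \in m}.

Definition semidirect m h k : Prop :=
  [/\ lie_subalgebra h, lie_subalgebra k, {in k & h, forall x y, lieb x y \in h},
      (h + k)%VS = m & (h :&: k)%VS = 0%VS].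

Definition restr_character m chi : Prop :=
  {in m &, forall x y, chi (lieb x y) = 0}.

Definition restr m chi (y : subvs_of m) : K := chi (vsval y).

(* U(L) ///_chi m                                                             *)
Definition uea_red m chi : pzAlgType K :=
  qhr (fun y : subvs_of m => uea_in (vsval y)) (restr chi).

(* Reduction by stages (U(L) ///_chi m) ///_kappa k: the comoment map sends y  *)
(* to its class. The adjoint action of y on the class of u is the commutator  *)
(* of the class of y with that of u.                                          *)
Definition stage_comoment m chi k (y : subvs_of k) : uea_red m chi :=
  qhr_of _ _ (uea_in (vsval y)).

Definition stage_red m chi k (kappa : subvs_of k -> K) : pzAlgType K :=
  qhr (@stage_comoment m chi k) kappa.

End LieTheory.

Section SpecialLinear.
Variables (K : fieldType) (n : nat).

Definition traceless : {vspace 'M[K]_n} :=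
  lker (linfun (mxtrace : 'M[K]_n -> K^o)).

Lemma tracelessP (A : 'M[K]_n) : (A \in traceless) = (\tr A == 0).
Proof. by rewrite memv_ker lfunE. Qed.

Definition sl := subvs_of traceless.
HB.instance Definition _ := Vector.on sl.

Definition to_sl (A : 'M[K]_n) : sl := vsproj traceless A.

Definition sl_lieb (x y : sl) : sl :=
  to_sl (vsval x *m vsval y - vsval y *m vsval x).

Lemma sl_liebE x y :
  vsval (sl_lieb x y) = vsval x *m vsval y - vsval y *m vsval x.
Proof.
by rewrite vsprojK // tracelessP linearB /= mxtrace_mulC subrr.
Qed.

Lemma sl_inj : injective (vsval : sl -> 'M[K]_n).
Proof. exact: val_inj. Qed.
Lemma sl_valP a (u v : sl) : vsval (a *: u + v) = a *: vsval u + vsval v.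
Proof. exact: linearP. Qed.
Lemma sl_valD (u v : sl) : vsval (u + v) = vsval u + vsval v.
Proof. exact: linearD. Qed.
Lemma sl_val0 : vsval (0 : sl) = 0.
Proof. exact: linear0. Qed.

Lemma sl_lieb_linearl y : linear (sl_lieb^~ y).
Proof.
move=> a u v; apply: sl_inj; rewrite sl_valP !sl_liebE sl_valP.
by rewrite mulmxDl mulmxDr -scalemxAl -scalemxAr scalerBr opprD addrACA.
Qed.
Lemma sl_lieb_linearr x : linear (sl_lieb x).
Proof.
move=> a u v; apply: sl_inj; rewrite sl_valP !sl_liebE sl_valP.
by rewrite mulmxDl mulmxDr -scalemxAl -scalemxAr scalerBr opprD addrACA.
Qed.
Lemma sl_liebxx x : sl_lieb x x = 0.
Proof. by apply: sl_inj; rewrite sl_liebE subrr sl_val0. Qed.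
Lemma sl_lieb_jacobi x y z :
  sl_lieb x (sl_lieb y z) + sl_lieb y (sl_lieb z x) + sl_lieb z (sl_lieb x y) = 0.
Proof.
apply: sl_inj; rewrite !sl_valD sl_val0 !sl_liebE.
rewrite !mulmxBr !mulmxBl !mulmxA !opprB.
move: (vsval x) (vsval y) (vsval z) => X Y Z.
move: (X *m Y *m Z) (X *m Z *m Y) (Y *m Z *m X) => a b c.
move: (Y *m X *m Z) (Z *m X *m Y) (Z *m Y *m X) => d e f.
by apply/matrixP => p q; rewrite !mxE; ring.
Qed.
HB.instance Definition _ := isLieAlgebra.Build K sl
  sl_lieb_linearl sl_lieb_linearr sl_liebxx sl_lieb_jacobi.

End SpecialLinear.

Section JordanType.
Variables (K : fieldType) (n : nat).

(* The Jordan matrix with eigenvalue 0 and blocks of sizes p_0, p_1, ...      *)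
(* (sumn p = n): reshape_index p k is the block containing the index k.       *)
Definition jordan_mx (p : seq nat) : 'M[K]_n :=
  \matrix_(k, l) ((l == k.+1 :> nat)
                  && (reshape_index p k == reshape_index p l))%:R.

Definition nilpotent_mx (A : 'M[K]_n) := exists N : nat, A ^+ N = 0.

Definition jordan_type (A : 'M[K]_n) (p : seq nat) :=
  A ~_{in unitmx} (jordan_mx p).

End JordanType.

Definition is_part (n : nat) (p : seq nat) : bool :=
  [&& sorted geq p, 0 \notin p & sumn p == n]%N.

Definition dominates (p q : seq nat) : Prop :=
  forall k, (sumn (take k q) <= sumn (take k p))%N.

Definition covers (n : nat) (p q : seq nat) : Prop :=
  [/\ is_part n p, is_part n q, dominates p q, p <> q
    & forall r, is_part n r -> dominates p r -> dominates r q -> r = p \/ r = q].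

(* Parts and rows are numbered from 0, and nth 0 pads partitions with zeros.  *)
Definition box_move (la mu : seq nat) (i j : nat) : Prop :=
  [/\ (i < j)%N, nth 0%N la i = (nth 0%N mu i).+1,
      (nth 0%N la j).+1 = nth 0%N mu j
    & forall s, s <> i -> s <> j -> nth 0%N la s = nth 0%N mu s].

Section Pyramid.
Variables (K : fieldType) (n : nat) (mu : seq nat).

(* The boxes of the right-aligned pyramid, listed in the order of their       *)
(* labels, as pairs (row, index of the column).                               *)
Definition pyr_boxes : seq (nat * nat) :=
  [seq (r, c) | c <- iota 0 (head 0 mu),
                r <- [seq r <- iota 0 (size mu) | head 0 mu - nth 0 mu r <= c]]%N.

Definition box_row (k : nat) : nat := (nth (0, 0) pyr_boxes k).1%N.
Definition box_col (k : nat) : int := (2 * (nth (0, 0) pyr_boxes k).2)%N.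

Definition box_arrow (k l : nat) : bool :=
  (box_row k == box_row l) && (box_col l == box_col k + 2).

(* Used for k <> l only, where the matrix unit is traceless.                  *)
Definition sl_unit (k l : 'I_n) : sl K n := to_sl (delta_mx k l).

Definition pyr_e1 : sl K n :=
  \sum_(k < n) \sum_(l < n | box_arrow k l) sl_unit k l.

Definition pyr_e2 (i j : nat) : sl K n :=
  pyr_e1 + \sum_(k < n) \sum_(l < n | [&& box_row k == i, box_row l == j
                                         & box_col k == box_col l]) sl_unit k l.

Definition pyr_E (i j m : nat) : sl K n :=
  \sum_(k < n) \sum_(l < n | [&& (i <= box_row k)%N, (box_row k < box_row l)%N,
      (box_row l <= j)%N, (box_row l - box_row k == m)%N
    & box_col k == box_col l]) sl_unit l k.

Definition box_deg (k l : 'I_n) : int := box_col l - box_col k.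

(* The component of degree d of sl_n: the traceless matrices in the span of   *)
(* the matrix units of degree d.                                              *)
Definition pyr_gr (d : int) : {vspace sl K n} :=
  (linfun vsval @^-1:
     \sum_(kl : 'I_n * 'I_n | box_deg kl.1 kl.2 == d) <[delta_mx kl.1 kl.2]>)%VS.

Definition pyr_degrees : seq int :=
  undup [seq box_deg kl.1 kl.2 | kl : 'I_n * 'I_n].

Definition pyr_m1 : {vspace sl K n} :=
  (\sum_(d <- pyr_degrees | (d <= -2)%R) pyr_gr d)%VS.

Definition pyr_k (i j : nat) : {vspace sl K n} :=
  <<[seq pyr_E i j m | m <- iota 1 (j - i)]>>%VS.

Definition pyr_m2 (i j : nat) : {vspace sl K n} := (pyr_m1 + pyr_k i j)%VS.

End Pyramid.

(* Main.v *)
From HB Require Import structures.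
Require Import Defs.
From mathcomp Require Import all_boot all_order all_algebra.
From mathcomp Require Import reals complex.
From mathcomp Require Import zify ring.

Import Order.TTheory GRing.Theory Num.Theory.
Local Open Scope ring_scope.

Set Implicit Arguments.
Unset Strict Implicit.
Unset Printing Implicit Defensive.

(** Why the theorem is true.

    The covering relation amounts to moving one box to an earlier row: if [la]
    strictly dominates [mu], moving a box of [mu] from the row where the prefix
    sums of [la] and [mu] meet again to the row where they first separate
    gives a partition that is dominated by [la] and strictly dominates [mu],
    so a covering [la] must equal it ([covers_box_move]). From there on only
    the move matters.

    Acting on row vectors, [e2] sends the box (r, c) to (r, c + 1), and
    (i, c) additionally to (j, c) if that is a box. Rows other than i and j
    are Jordan chains already. Rows i and j, of lengths p >= q, recombine: the
    chain of the first box of row i gains one step, because after p steps a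
    multiple q of the last box of row j is left over, and a suitable
    combination of boxes of the two rows spans a complementary chain of length
    q - 1. Characteristic 0 enters through q being invertible. The chains form
    a basis on which [e2] is the Jordan matrix of [la] ([chain_mx_conj],
    [chain_mx_unit], [pyr_e2_jordan_type]).

    On sl_n the Killing form is 2n times the trace form ([killing_sl]), so all
    statements on characters become trace computations. Three facts on the
    generators E_m are needed: they have degree 0, they commute with each
    other, and they commute with [e1]. The last two hold because moving m rows
    down the pyramid stays inside it, and because the rows are right-aligned,
    so that this commutes with moving right. Hence [lieb] maps m2 x m2 into
    m1, where [chi1] and [chi2] agree as [e2 - e1] has degree 0, and [chi1]
    kills these brackets: for degree reasons on m1 x m1, and by invariance of
    the form as soon as one argument is in k ([pyr_m2_lieb]).

    The algebra homomorphism exists for any algebra and comoment maps such that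
    k acts through classes that are invariant in the first stage, the relations
    of both stages hold in the one-shot quotient, and the comoment map of m2 is
    split by those of m1 and k ([reduction_by_stages]). Invariance of the
    classes of k is what the vanishing of the coadjoint action on [chi1] gives
    ([stage_comomentE]). *)

(** * Partitions and the dominance order *)

Section Dominance.
Local Open Scope nat_scope.

Lemma sumn_take_nth s k : sumn (take k s) = \sum_(t < k) nth 0 s t.
Proof.
elim: k s => [|k IH] [|x s] //=; rewrite ?big_ord0 ?big_ord_recl //=.
  by rewrite big1 // => t _; rewrite nth_nil.
by rewrite IH.
Qed.

Lemma part_nth_nonincr n p : is_part n p -> {homo nth 0 p : a b / a <= b >-> b <= a}.
Proof.
move=> /and3P[p_sorted _ _] a b le_ab.
have [b_lt|?] := ltnP b (size p); last by rewrite (nth_default _ (n := b)).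
have geq_trans : transitive geq by move=> x y z /= yx zx; exact: leq_trans zx yx.
exact: (sorted_leq_nth geq_trans leqnn 0 p_sorted a b (leq_ltn_trans le_ab b_lt) b_lt le_ab).
Qed.

Lemma part_nth_gt0 n p t : is_part n p -> (0 < nth 0 p t) = (t < size p).
Proof.
move=> /and3P[_ p0 _]; have [t_lt|?] := ltnP t (size p); last by rewrite nth_default.
by rewrite lt0n; apply: contra p0 => /eqP <-; exact: mem_nth.
Qed.

Lemma part_eq n p q : is_part n p -> is_part n q -> nth 0 p =1 nth 0 q -> p = q.
Proof.
move=> pp pq epq; apply: (@eq_from_nth _ 0) => [|t _]; last exact: epq.
have [] := ltngtP (size p) (size q) => //.
  by rewrite -(part_nth_gt0 _ pq) -epq (part_nth_gt0 _ pp) ltnn.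
by rewrite -(part_nth_gt0 _ pp) epq (part_nth_gt0 _ pq) ltnn.
Qed.

Lemma part_sum n p k : is_part n p -> size p <= k -> \sum_(t < k) nth 0 p t = n.
Proof. by move=> /and3P[_ _ /eqP <-] le_k; rewrite -sumn_take_nth take_oversize. Qed.

(** A partition is given by any nonincreasing function with finite support:
    its values are positive exactly on an initial segment, and the filter only
    cuts off the zeros that follow. *)
Lemma part_of_fun (f : nat -> nat) N : {homo f : a b / a <= b >-> b <= a} ->
  f N = 0 -> is_part (\sum_(t < N) f t) [seq x <- mkseq f N | x != 0] /\
             nth 0 [seq x <- mkseq f N | x != 0] =1 f.
Proof.
move=> f_mono fN0; pose k := find (fun t => f t == 0) (iota 0 N).
have le_kN : k <= N by rewrite -[leqRHS](size_iota 0 N) find_size.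
have f_gt0 t : t < k -> f t != 0.
  by move=> lt_tk; have := before_find 0 lt_tk; rewrite nth_iota ?(leq_trans lt_tk) // => ->.
have f_eq0 t : k <= t -> f t = 0.
  move=> le_kt; suff fk0 : f k = 0 by apply/eqP; rewrite -leqn0 -fk0 f_mono.
  have [lt_kN|le_Nk] := ltnP k N; last by have -> : k = N by lia.
  have: has (fun t => f t == 0) (iota 0 N) by rewrite has_find size_iota.
  by move=> /(nth_find 0); rewrite nth_iota // => /eqP.
have -> : [seq x <- mkseq f N | x != 0] = mkseq f k.
  rewrite /mkseq -(subnKC le_kN) iotaD map_cat filter_cat.
  rewrite (all_filterP _); last first.
    by apply/allP=> _ /mapP[t + ->]; rewrite mem_iota; apply: f_gt0.
  rewrite -[RHS]cats0; congr (_ ++ _); apply/eqP; rewrite -size_eq0 size_filter.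
  rewrite -leqn0 leqNgt -has_count; apply/hasPn => _ /mapP[t + ->].
  by rewrite mem_iota negbK => /andP[/f_eq0 ->].
have nth_f : nth 0 (mkseq f k) =1 f.
  move=> t; have [lt_tk|le_kt] := ltnP t k; first exact: nth_mkseq.
  by rewrite nth_default ?size_mkseq // f_eq0.
split=> //; apply/and3P; split.
- by apply/(sortedP 0) => t _; rewrite !nth_f; apply: f_mono.
- by apply/mapP => -[t]; rewrite mem_iota => /f_gt0 /[swap] <-.
- rewrite -[mkseq f k](@take_oversize _ N) ?size_mkseq // sumn_take_nth.
  by apply/eqP; apply: eq_bigr => t _.
Qed.

(** With i the first row where the prefix sums separate and j > i the first row
    where they agree again, [la] is strictly ahead of [mu] in between. So moving
    one box of [mu] from row j to row i stays dominated by [la]; it yields a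
    partition because [mu] drops strictly just before row i and just after row
    j, and it differs from [mu]. *)
Lemma covers_box_move n la mu : covers n la mu -> exists i j, box_move la mu i j.
Proof.
case=> pla pmu dom la_neq cov.
(* S p k is the k-th prefix sum of the parts of p. *)
pose S p k := \sum_(t < k) nth 0 p t.
have SS p k : S p k.+1 = S p k + nth 0 p k by rewrite /S big_ord_recr.
have leS k : S mu k <= S la k by rewrite /S -!sumn_take_nth.
have ex_i : exists i, S mu i.+1 < S la i.+1.
  apply: boolp.contrapT => all_eq.
  have eqS k : S mu k = S la k.
    case: k => [|k]; first by rewrite /S !big_ord0.
    by apply/eqP; rewrite eqn_leq leS leqNgt; apply/negP => lt_k; apply: all_eq; exists k.
  apply/la_neq/(part_eq pla pmu) => t.
  by have := eqS t.+1; rewrite !SS eqS => /addnI.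
have [i lt_i min_i] := ex_minnP ex_i.
have eq_i k : k <= i -> S mu k = S la k.
  case: k => [|k le_ki]; first by rewrite /S !big_ord0.
  by apply/eqP; rewrite eqn_leq leS leqNgt; apply/negP => /min_i; rewrite leqNgt le_ki.
have ex_j : exists j, (i < j) && (S mu j.+1 == S la j.+1).
  exists (i + size mu + size la).+1; rewrite /S !(@part_sum n) ?eqxx //; lia.
have [j /andP[lt_ij /eqP eq_j] min_j] := ex_minnP ex_j.
have lt_k k : i < k -> k <= j -> S mu k < S la k.
  case: k => // k; rewrite ltnS leq_eqVlt => /predU1P[<- //|lt_ik le_kj].
  rewrite ltn_neqAle leS andbT; apply/negP => eq_k.
  by have := min_j k; rewrite lt_ik eq_k => /(_ isT); lia.
have la_mono := part_nth_nonincr pla; have mu_mono := part_nth_nonincr pmu.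
have la_i : nth 0 mu i < nth 0 la i by have := lt_i; rewrite !SS eq_i // ltn_add2l.
have la_j : nth 0 la j < nth 0 mu j.
  by have := lt_k j lt_ij (leqnn j); have := eq_j; rewrite !SS; lia.
have mu_j1 : nth 0 mu j.+1 < nth 0 mu j.
  apply: leq_ltn_trans la_j; apply: leq_trans (la_mono j j.+1 (leqnSn j)).
  by have := leS j.+2; rewrite SS [in leqRHS]SS eq_j leq_add2l.
have mu_i1 t : t < i -> nth 0 mu i < nth 0 mu t.
  move=> lt_ti; apply: leq_trans la_i _.
  have <- : nth 0 la t = nth 0 mu t.
    by have := eq_i _ lt_ti; rewrite !SS (eq_i t) ?(ltnW lt_ti) // => /addnI.
  exact/la_mono/ltnW.
pose f t := nth 0 mu t + (t == i) - (t == j).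
have f_mono : {homo f : a b / a <= b >-> b <= a}.
  move=> a b; rewrite leq_eqVlt => /predU1P[-> //|lt_ab].
  have := mu_mono a b (ltnW lt_ab); rewrite /f.
  have [eb|nb] := eqVneq b i.
    by rewrite eb in lt_ab *; have := mu_i1 a lt_ab; lia.
  have [ea|na] := eqVneq a j; last by lia.
  by rewrite ea in lt_ab *; have := mu_mono _ _ lt_ab; lia.
have jmu : j < size mu by rewrite -(part_nth_gt0 _ pmu); lia.
have f0 : f (size mu) = 0 by rewrite /f nth_default //; lia.
have [] := part_of_fun f_mono f0; set r := filter _ _ => pr nth_r.
have Sr k : S r k + (j < k) = S mu k + (i < k).
  elim: k => [|k]; first by rewrite /S !big_ord0.
  by rewrite !SS nth_r /f; have [->|] := eqVneq k j; lia.
have {}pr : is_part n r.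
  rewrite -(part_sum pmu (leqnn _)) (_ : \sum_(t < _) _ = \sum_(t < size mu) f t) //.
  transitivity (S r (size mu)); last by apply: eq_bigr => t _; rewrite nth_r.
  by have := Sr (size mu); rewrite jmu (ltn_trans lt_ij jmu) => /addIn.
case: (cov r pr).
- move=> k; rewrite !sumn_take_nth -/(S r k) -/(S la k).
  have := Sr k; have := leS k.
  by case: (ltnP i k) => [/lt_k|]; case: (ltnP j k) => //; lia.
- move=> k; rewrite !sumn_take_nth -/(S r k) -/(S mu k).
  by have := Sr k; lia.
- move=> rla; exists i, j; rewrite -rla; split=> //.
  + by rewrite nth_r /f; lia.
  + by rewrite nth_r /f; lia.
  + by move=> s /eqP ? /eqP ?; rewrite nth_r /f; lia.
- by move=> rmu; have := nth_r i; rewrite rmu /f; lia.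
Qed.

End Dominance.

(** * The pyramid and its matrices *)

Lemma sum_sl_unit (K : fieldType) n (P : rel 'I_n) : irreflexive P ->
  vsval (\sum_k \sum_(l | P k l) sl_unit K k l) = \matrix_(k, l) (P k l)%:R.
Proof.
move=> irr; rewrite linear_sum /= [RHS]matrix_sum_delta; apply: eq_bigr => k _.
rewrite linear_sum [RHS](bigID (P k)) /= [X in _ = _ + X]big1 ?addr0; last first.
  by move=> l /negPf Pkl; rewrite mxE Pkl scale0r.
apply: eq_bigr => l Pkl; rewrite mxE Pkl scale1r vsprojK // tracelessP.
rewrite /mxtrace big1 // => t _; rewrite mxE.
by case: eqP => // ->; case: eqP => // kl; rewrite -kl irr in Pkl.
Qed.

Section PyramidBoxes.
Variables (n : nat) (mu : seq nat).
Hypothesis pmu : is_part n mu.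

Lemma part_nth_le_head r : (nth 0 mu r <= head 0 mu)%N.
Proof. by rewrite -nth0; apply: (part_nth_nonincr pmu). Qed.

Lemma mem_pyr_boxes r c :
  ((r, c) \in pyr_boxes mu) = (head 0 mu - nth 0 mu r <= c < head 0 mu)%N.
Proof.
apply/allpairsPdep/idP => [[c' [r' []]]|/andP[ge_c lt_c]].
  by rewrite mem_iota mem_filter add0n => /= lt_c /andP[ge_c _] [-> ->]; rewrite ge_c.
have r_lt : (r < size mu)%N by rewrite -(part_nth_gt0 _ pmu); lia.
by exists c, r; rewrite mem_iota mem_filter mem_iota ge_c add0n r_lt.
Qed.

Lemma uniq_pyr_boxes : uniq (pyr_boxes mu).
Proof.
apply: allpairs_uniq_dep => [|c _|]; first exact: iota_uniq.
  by rewrite filter_uniq ?iota_uniq.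
by move=> [c r] [c' r'] _ _ /= [-> ->].
Qed.

(** The boxes are listed by columns, but their number is the sum of the row
    lengths; the same boxes are therefore listed by rows. *)
Lemma size_pyr_boxes : size (pyr_boxes mu) = n.
Proof.
have [_ _ /eqP sum_mu] := and3P pmu.
pose t := [seq (r, c) | r <- iota 0 (size mu),
             c <- iota (head 0 mu - nth 0 mu r) (nth 0 mu r)]%N.
have -> : n = size t.
  rewrite size_allpairs_dep -sum_mu; congr sumn.
  apply: (@eq_from_nth _ 0) => [|r r_lt]; first by rewrite size_map size_iota.
  by rewrite (nth_map 0) ?size_iota ?nth_iota.
apply/perm_size/uniq_perm; first exact: uniq_pyr_boxes.
  apply: allpairs_uniq_dep => [|r _|]; [exact: iota_uniq|exact: iota_uniq|].
  by move=> [c r] [c' r'] _ _ /= [-> ->].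
move=> [r c]; rewrite mem_pyr_boxes; have le_M := part_nth_le_head r.
apply/idP/allpairsPdep => [rc|[r' [c' []]]].
  exists r, c; split=> //; rewrite mem_iota ?subnK // ?add0n.
  by rewrite -(part_nth_gt0 _ pmu); lia.
by rewrite !mem_iota => _ + [rr cc]; rewrite rr cc in le_M *; lia.
Qed.

Definition box (k : nat) := nth (0, 0)%N (pyr_boxes mu) k.

Lemma box_in (k : 'I_n) : box k \in pyr_boxes mu.
Proof. by rewrite mem_nth ?size_pyr_boxes. Qed.

Lemma box_label b : b \in pyr_boxes mu -> exists k : 'I_n, box k = b.
Proof.
move=> b_in; have lt_n : (index b (pyr_boxes mu) < n)%N.
  by rewrite -size_pyr_boxes index_mem.
by exists (Ordinal lt_n); apply: nth_index.
Qed.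

Lemma box_inj : injective (fun k : 'I_n => box k).
Proof.
move=> k l /eqP; rewrite nth_uniq ?size_pyr_boxes ?uniq_pyr_boxes //.
by move=> /eqP/val_inj.
Qed.

Lemma box_arrowE (k l : nat) :
  box_arrow mu k l = (box l == ((box k).1, (box k).2.+1)).
Proof.
rewrite /box_arrow /box_row /box_col -/(box k) -/(box l) eq_sym -pair_eqE /=.
by congr andb; lia.
Qed.

Lemma box_colE (k l : nat) : (box_col mu k == box_col mu l) = ((box k).2 == (box l).2).
Proof. by rewrite /box_col -/(box k) -/(box l); lia. Qed.

Variable K : fieldType.
Implicit Types A B : 'M[K]_n.

(** The basis vector of the box b, extended by 0 to positions outside of the
    pyramid: chains of boxes then end by themselves. *)
Definition box_vec (b : nat * nat) : 'rV[K]_n := \row_k (box k == b)%:R.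

Lemma box_vec_delta (k : 'I_n) : box_vec (box k) = delta_mx 0 k.
Proof.
by apply/rowP => l; rewrite !mxE eqxx /= (inj_eq box_inj).
Qed.

Lemma box_vec_out b : b \notin pyr_boxes mu -> box_vec b = 0.
Proof.
move=> b_out; apply/rowP => l; rewrite !mxE; case: eqP => // bl.
by rewrite -bl box_in in b_out.
Qed.

Lemma box_vec_mul (P : rel (nat * nat)) b : b \in pyr_boxes mu ->
  box_vec b *m (\matrix_(k, l) (P (box k) (box l))%:R : 'M[K]_n)
    = \row_l (P b (box l))%:R.
Proof.
move=> /box_label[k <-]; rewrite box_vec_delta -rowE.
by apply/rowP => l; rewrite !mxE.
Qed.

Lemma eq_mx_box_vec A B :
  (forall b, b \in pyr_boxes mu -> box_vec b *m A = box_vec b *m B) -> A = B.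
Proof.
move=> eqAB; apply/row_matrixP => k.
by rewrite !rowE -box_vec_delta; apply/eqAB/box_in.
Qed.

Lemma pyr_e1_mx : vsval (pyr_e1 K n mu) =
  \matrix_(k, l) (box l == ((box k).1, (box k).2.+1))%:R.
Proof.
rewrite sum_sl_unit => [|k].
  by apply/matrixP => k l; rewrite !mxE box_arrowE.
by rewrite box_arrowE -pair_eqE /=; lia.
Qed.

Lemma pyr_e2_mx i j : (i < j)%N -> vsval (pyr_e2 K n mu i j) =
  vsval (pyr_e1 K n mu) +
  \matrix_(k, l) [&& (box k).1 == i, (box l).1 == j & (box k).2 == (box l).2]%:R.
Proof.
move=> lt_ij; rewrite linearD /= [X in _ + X]sum_sl_unit => [|k].
  by congr (_ + _); apply/matrixP => k l; rewrite !mxE box_colE.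
by lia.
Qed.

Lemma pyr_E_mx i j m : (0 < m)%N -> vsval (pyr_E K n mu i j m) =
  \matrix_(k, l) [&& i <= (box l).1, (box k).1 <= j,
                     (box k).1 == (box l).1 + m & (box k).2 == (box l).2]%N%:R.
Proof.
move=> m_gt0; pose P (l k : 'I_n) := [&& i <= box_row mu k, box_row mu k < box_row mu l,
    box_row mu l <= j, box_row mu l - box_row mu k == m & box_col mu k == box_col mu l]%N.
have -> : pyr_E K n mu i j m = \sum_l \sum_(k | P l k) sl_unit K l k.
  by rewrite /pyr_E (exchange_big_dep predT).
rewrite sum_sl_unit => [|k]; last by rewrite /P; lia.
apply/matrixP => k l; rewrite !mxE /P box_colE /box_row -!/(box _); congr (_%:R); lia.
Qed.

Lemma box_vec_e1 r c : (r, c) \in pyr_boxes mu ->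
  box_vec (r, c) *m vsval (pyr_e1 K n mu) = box_vec (r, c.+1).
Proof.
move=> rc; rewrite pyr_e1_mx.
by rewrite (@box_vec_mul (fun a b => b == (a.1, a.2.+1))).
Qed.

Lemma box_vec_e2 i j r c : (i < j)%N -> (r, c) \in pyr_boxes mu ->
  box_vec (r, c) *m vsval (pyr_e2 K n mu i j)
    = box_vec (r, c.+1) + (r == i)%:R *: box_vec (j, c).
Proof.
move=> lt_ij rc; rewrite pyr_e2_mx // mulmxDr box_vec_e1 //; congr (_ + _).
rewrite (@box_vec_mul (fun a b => [&& a.1 == i, b.1 == j & a.2 == b.2])) //.
apply/rowP => l; rewrite !mxE /= -pair_eqE /= [c == _]eq_sym.
by case: eqP; rewrite ?mul1r ?mul0r.
Qed.

Lemma box_vec_E i j m r c : (0 < m)%N -> (r, c) \in pyr_boxes mu ->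
  box_vec (r, c) *m vsval (pyr_E K n mu i j m)
    = (i + m <= r <= j)%N%:R *: box_vec (r - m, c)%N.
Proof.
move=> m_gt0 rc; rewrite pyr_E_mx //.
rewrite (@box_vec_mul (fun a b => [&& i <= b.1, a.1 <= j,
                     a.1 == b.1 + m & a.2 == b.2]%N)) //.
apply/rowP => l; rewrite !mxE -natrM mulnb -pair_eqE /=; congr (_%:R); lia.
Qed.

(** Lower rows are longer and end in the same column, so they contain
    every column met by a higher row. *)
Lemma pyr_boxes_below r m c : (r, c) \in pyr_boxes mu -> (r - m, c)%N \in pyr_boxes mu.
Proof.
rewrite !mem_pyr_boxes; have := part_nth_nonincr pmu (leq_subr m r); lia.
Qed.

(** Both products send the box (r, c) to (r - m, c + 1). Right alignment matters
    where a step to the right leaves the pyramid: it does so in all rows at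
    once. *)
Lemma pyr_E_comm_e1 i j m : (0 < m)%N ->
  vsval (pyr_E K n mu i j m) *m vsval (pyr_e1 K n mu)
    = vsval (pyr_e1 K n mu) *m vsval (pyr_E K n mu i j m).
Proof.
move=> m_gt0; apply: eq_mx_box_vec => -[r c] rc; rewrite !mulmxA.
rewrite box_vec_E // box_vec_e1 // -scalemxAl box_vec_e1 ?pyr_boxes_below //.
have [rc'|rc'] := boolP ((r, c.+1) \in pyr_boxes mu); first by rewrite box_vec_E.
rewrite (box_vec_out rc') mul0mx box_vec_out ?scaler0 //.
have := part_nth_nonincr pmu (leq_subr m r).
move: rc rc'; rewrite !mem_pyr_boxes; lia.
Qed.

(** Both products move a box down by m + p rows under the same condition on its
    row, as the intermediate box is never missing. *)
Lemma pyr_E_comm i j m p : (0 < m)%N -> (0 < p)%N ->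
  vsval (pyr_E K n mu i j m) *m vsval (pyr_E K n mu i j p)
    = vsval (pyr_E K n mu i j p) *m vsval (pyr_E K n mu i j m).
Proof.
move=> m_gt0 p_gt0; apply: eq_mx_box_vec => -[r c] rc; rewrite !mulmxA.
rewrite !box_vec_E // -!scalemxAl !box_vec_E ?pyr_boxes_below //.
rewrite !scalerA -!natrM !mulnb -!subnDA [(p + m)%N]addnC; congr (_%:R *: _); lia.
Qed.

End PyramidBoxes.

(** * Jordan type of the second nilpotent *)

(** The N-th power only has entries on the N-th superdiagonal. *)
Lemma jordan_mx_nilpotent (K : fieldType) n p : nilpotent_mx (jordan_mx K n p).
Proof.
set J := jordan_mx K n p.
have JX N k l : (J ^+ N) k l != 0 -> (l = k + N :> nat)%N.
  elim: N k l => [|N IH] k l.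
    by rewrite expr0 mxE; case: (k =P l) => [-> _|]; rewrite ?addn0 // eqxx.
  rewrite exprS -mulmxE mxE; apply: contraNeq => ne; rewrite big1 // => s _.
  have [JN0|/IH els] := eqVneq ((J ^+ N) s l) 0; first by rewrite JN0 mulr0.
  rewrite mxE; case: eqP => [es|]; rewrite ?mul0r //; case: ne; lia.
exists n; apply/matrixP => k l; rewrite [RHS]mxE; apply/eqP/negPn/negP => /JX.
by have := ltn_ord l; lia.
Qed.

Lemma nilpotent_mx_conj (K : fieldType) n (P A B : 'M[K]_n) : P \in unitmx ->
  P *m A = B *m P -> nilpotent_mx B -> nilpotent_mx A.
Proof.
move=> Pu PA [N BN]; exists N.
have PAX m : P *m A ^+ m = B ^+ m *m P.
  elim: m => [|m IH]; first by rewrite !expr0 mulmx1 mul1mx.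
  by rewrite exprSr -mulmxE mulmxA IH -mulmxA PA mulmxA mulmxE -exprSr.
by rewrite -[_ ^+ N](mulKmx Pu) PAX BN mul0mx mulmx0.
Qed.

Section JordanChains.
Variables (K : fieldType) (n : nat) (mu la : seq nat) (i j : nat).
Hypotheses (pmu : is_part n mu) (pla : is_part n la) (mv : box_move la mu i j).
Hypothesis charK : [pchar K] =i pred0.

Let M := head 0%N mu.
Let q := nth 0%N mu j.
Let start r := (M - nth 0 mu r)%N.
Let e2 := vsval (pyr_e2 K n mu i j).
Local Notation bv r c := (box_vec n mu K (r, c)).

Let lt_ij : (i < j)%N. Proof. by case: mv. Qed.
Let q_gt0 : (0 < q)%N. Proof. by case: mv => _ _ e _; rewrite /q -e. Qed.
Let la_i : nth 0%N la i = (nth 0%N mu i).+1. Proof. by case: mv. Qed.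
Let la_j : nth 0%N la j = q.-1. Proof. by case: mv => _ _ e _; rewrite /q -e. Qed.
Let la_r r : r != i -> r != j -> nth 0%N la r = nth 0%N mu r.
Proof. by move=> /eqP ri /eqP rj; case: mv => _ _ _; apply. Qed.
Let le_q : (q <= nth 0%N mu i)%N.
Proof. exact: part_nth_nonincr pmu _ _ (ltnW lt_ij). Qed.
Let le_M r : (nth 0%N mu r <= M)%N.
Proof. exact: part_nth_le_head pmu r. Qed.
Let q_neq0 : q%:R != 0 :> K.
Proof. by have [/(_ charK)-> _] := pcharf0P K; rewrite -lt0n. Qed.

Let in_boxes r c : ((r, c) \in pyr_boxes mu) = (start r <= c < M)%N.
Proof. exact: mem_pyr_boxes pmu r c. Qed.

Let bv_out r c : (c < start r)%N || (M <= c)%N -> bv r c = 0.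
Proof. by move=> out; rewrite box_vec_out // in_boxes; lia. Qed.

Let bv_e2 r c : (start r <= c < M)%N ->
  bv r c *m e2 = bv r c.+1 + (r == i)%:R *: bv j c.
Proof. by rewrite -in_boxes => rc; rewrite /e2 (box_vec_e2 pmu _ lt_ij rc). Qed.

(** The t-th vector of the Jordan chain of length [nth 0 la r]. In row i it is
    the t-th iterate of [e2] on the first box: the coefficient counts the
    positions at which the path may have dropped from row i to row j. In row j
    the coefficients are chosen so that they vanish at the step where the
    chain leaves the pyramid, which happens one step early; the pair of chains
    then has determinant -q in each column. *)
Definition chain_vec r t : 'rV[K]_n :=
  if r == i then bv i (start i + t)%N
                 + (start i + t - start j)%N%:R *: bv j (start i + t).-1
  else if r == j then bv i (start j + t).+1 - (q - t.+1)%N%:R *: bv j (start j + t)%N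
  else bv r (start r + t)%N.

Lemma chain_vec_step r t : (t < nth 0 la r)%N ->
  chain_vec r t *m e2 = chain_vec r t.+1.
Proof.
rewrite /chain_vec; have [->|ri] := eqVneq r i.
  rewrite la_i ltnS => le_t; rewrite mulmxDl -scalemxAl addnS /=.
  move: (le_M i) (le_M j) => leMi leMj.
  set c := (start i + t)%N; have le_c : (start i <= c <= M)%N by rewrite /c /start; lia.
  have [lt_cM|ge_cM] := ltnP c M; last first.
    have -> : c = M by lia.
    rewrite !(@bv_out i) ?(@bv_out j M) ?leqnn ?leqnSn ?orbT // mul0mx add0r.
    rewrite bv_e2 ?prednK ?(@bv_out j M) ?leqnn ?orbT //; try (rewrite /start; lia).
    by rewrite gtn_eqF // scale0r !scaler0 !addr0 ?scaler0.
  rewrite bv_e2 ?lt_cM ?andbT; last by lia.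
  rewrite eqxx scale1r -addrA; congr (_ + _).
  have [lt_c|gt_c|eq_c] := ltngtP c (start j).
  - by rewrite (@bv_out j c) ?lt_c // add0r scaler0 (eqP (ltnW lt_c)) scale0r.
  - rewrite bv_e2; last by lia.
    rewrite prednK; last by lia.
    rewrite gtn_eqF // scale0r addr0 subSn ?(ltnW gt_c) // -natr1 scalerDl.
    by rewrite scale1r addrC.
  - by rewrite eq_c subnn scale0r addr0 subSnn scale1r.
have [->|rj] := eqVneq r j; last first.
  rewrite la_r // => lt_t; rewrite bv_e2; last by move: (le_M r); rewrite /start; lia.
  by rewrite (negPf ri) scale0r addr0 addnS.
rewrite la_j => lt_t; rewrite mulmxBl -scalemxAl addnS.
move: (le_M i) (le_M j) => leMi leMj.
rewrite bv_e2; last by rewrite /start; lia.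
rewrite bv_e2; last by rewrite /start -/q; lia.
rewrite eqxx scale1r gtn_eqF // scale0r addr0 -addrA; congr (_ + _).
rewrite [(q - t.+1)%N](_ : _ = (q - t.+2).+1)%N; last by lia.
by rewrite -natr1 scalerDl scale1r opprD addrC -addrA addNr addr0.
Qed.

Lemma chain_vec_end r : chain_vec r (nth 0%N la r) = 0.
Proof.
move: (le_M i) (le_M j) (le_M r) => leMi leMj leMr.
rewrite /chain_vec; have [->|ri] := eqVneq r i.
  by rewrite la_i addnS !bv_out ?scaler0 ?addr0 //; rewrite /start; lia.
have [->|rj] := eqVneq r j.
  rewrite la_j (_ : q - _ = 0)%N; last by lia.
  by rewrite scale0r subr0 bv_out // /start -/q; lia.
by rewrite la_r // bv_out // /start; lia.
Qed.

Let chain_mx : 'M[K]_n :=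
  \matrix_(k < n) chain_vec (reshape_index la k) (reshape_offset la k).

Let sum_la : sumn la = n. Proof. by case/and3P: pla => _ _ /eqP. Qed.

(** The index k of the Jordan matrix is the position t in the block r; its
    successor lies in the same block exactly while t + 1 is within the block,
    and otherwise the chain has reached 0. *)
Lemma chain_mx_conj : chain_mx *m e2 = jordan_mx K n la *m chain_mx.
Proof.
apply/row_matrixP => k; rewrite !row_mul rowK [RHS]mulmx_sum_row.
have lt_k : (k < sumn la)%N by rewrite sum_la.
set r := reshape_index la k; set t := reshape_offset la k.
have lt_t : (t < nth 0 la r)%N := reshape_offsetP lt_k.
have def_k : flatten_index la r t = k := reshape_indexK la k.
rewrite chain_vec_step //; have [lt_t1|ge_t1] := ltnP t.+1 (nth 0%N la r).
  have lt_k1 : (flatten_index la r t.+1 < n)%N by rewrite -sum_la flatten_indexP.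
  rewrite (bigD1 (Ordinal lt_k1)) //= big1 => [|l ne_l].
    rewrite !mxE /= rowK /= flatten_indexKl // flatten_indexKr // eqxx andbT.
    by rewrite -def_k /flatten_index addnS eqxx scale1r addr0.
  rewrite !mxE; case: eqP => [l_k|]; rewrite ?scale0r //; case/eqP: ne_l.
  by apply/val_inj; rewrite /= l_k -def_k /flatten_index addnS.
rewrite (_ : t.+1 = nth 0%N la r); last by lia.
rewrite chain_vec_end big1 // => l _; rewrite !mxE; case: eqP => [l_k|]; rewrite ?scale0r //.
case: eqP => [r_l|]; rewrite ?scale0r //.
have lt_l : (l < sumn la)%N by rewrite sum_la.
have := reshape_offsetP lt_l; have := reshape_indexK la l; rewrite -r_l -/r => def_l lt_o.
by exfalso; move: def_l def_k l_k; rewrite /flatten_index; lia.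
Qed.

Let chain_vec_sub r t : (t < nth 0 la r)%N -> (chain_vec r t <= chain_mx)%MS.
Proof.
move=> lt_t; have lt_k : (flatten_index la r t < n)%N by rewrite -sum_la flatten_indexP.
have <- : row (Ordinal lt_k) chain_mx = chain_vec r t; last exact: row_sub.
by rewrite rowK /= flatten_indexKl // flatten_indexKr.
Qed.

Let scale_sub (x : 'rV[K]_n) : (q%:R *: x <= chain_mx)%MS -> (x <= chain_mx)%MS.
Proof. by move=> qx; rewrite -[x](scalerK q_neq0) scalemx_sub. Qed.

(** All box vectors are combinations of chain vectors. In the columns shared by
    the rows i and j, the box (i, d + 1) and the box (j, d) occur together
    in one vector of each chain, and Cramer's rule solves for q times them. *)
Lemma chain_mx_unit : chain_mx \in unitmx.
Proof.
rewrite -row_full_unit -sub1mx; apply/row_subP => k.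
rewrite row1 -(box_vec_delta pmu); have := box_in pmu k.
case: (box mu k) => r c; rewrite in_boxes => rc.
move: (le_M i) (le_M j : q <= M)%N (le_M r) => leMi leMj leMr.
have ji : (j == i) = false by rewrite gtn_eqF.
have chain_i c' : (start i <= c' <= M)%N ->
    ((bv i c' + (c' - start j)%N%:R *: bv j c'.-1)%R <= chain_mx)%MS.
  case/andP=> ge_c' le_c'.
  have lt_t : (c' - start i < nth 0 la i)%N by rewrite la_i; rewrite /start in ge_c' *; lia.
  have := chain_vec_sub lt_t; by rewrite /chain_vec eqxx subnKC.
have chain_j d : (start j <= d)%N -> (d.+1 < M)%N ->
    ((bv i d.+1 - (M - d.+1)%N%:R *: bv j d)%R <= chain_mx)%MS.
  move=> dj dM; have lt_t : (d - start j < nth 0 la j)%N.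
    by rewrite la_j; rewrite /start -/q in dj *; lia.
  have -> : (M - d.+1 = q - (d - start j).+1)%N by rewrite /start -/q in dj *; lia.
  by have := chain_vec_sub lt_t; rewrite /chain_vec ji eqxx subnKC.
have le_st : (start i <= start j)%N by rewrite /start -/q; lia.
(* The two coefficients at d sum up to q, the determinant up to sign. *)
have split_q d : (start j <= d)%N -> (d.+1 < M)%N ->
    q%:R = (M - d.+1)%N%:R + (d.+1 - start j)%N%:R :> K.
  by move=> dj dM; rewrite -natrD; congr (_%:R); rewrite /start -/q in dj *; lia.
have [ri|ri] := eqVneq r i.
  rewrite ri in rc *; have [le_c|gt_c] := leqP c (start j).
    by have := chain_i c; rewrite (eqP le_c) scale0r addr0; apply; lia.
  have -> : c = c.-1.+1 by lia.
  set d := c.-1; have [dj dM] : (start j <= d)%N /\ (d.+1 < M)%N by lia.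
  apply: scale_sub; set b := bv i d.+1.
  have -> : q%:R *: b = (M - d.+1)%N%:R *: (b + (d.+1 - start j)%N%:R *: bv j d)
      + (d.+1 - start j)%N%:R *: (b - (M - d.+1)%N%:R *: bv j d).
    rewrite (split_q d) // scalerDl scalerDr scalerBr !scalerA [X in _ - X *: _]mulrC.
    by rewrite [RHS]addrACA subrr addr0.
  by rewrite addmx_sub ?scalemx_sub ?chain_j //; apply: (chain_i d.+1); lia.
have [rj|rj] := eqVneq r j; last first.
  have lt_t : (c - start r < nth 0 la r)%N by rewrite la_r; rewrite /start in rc *; lia.
  have := chain_vec_sub lt_t; rewrite /chain_vec (negPf ri) (negPf rj) subnKC //; by case/andP: rc.
rewrite rj in rc *; apply: scale_sub; have [lt_c|ge_c] := ltnP c.+1 M.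
  have -> : q%:R *: bv j c = (bv i c.+1 + (c.+1 - start j)%N%:R *: bv j c)
      - (bv i c.+1 - (M - c.+1)%N%:R *: bv j c).
    rewrite (split_q c) //; last by lia.
    by rewrite scalerDl opprB [RHS]addrC addrA subrK.
  by rewrite addmx_sub ?eqmx_opp ?chain_j //; [apply: (chain_i c.+1); lia|lia].
have -> : c = M.-1 by lia.
have := chain_i M; rewrite bv_out ?leqnn ?orbT // add0r (_ : M - start j = q)%N; last first.
  by rewrite /start -/q; lia.
by apply; rewrite /start; lia.
Qed.

Theorem pyr_e2_jordan_type :
  nilpotent_mx (vsval (pyr_e2 K n mu i j)) /\ jordan_type (vsval (pyr_e2 K n mu i j)) la.
Proof.
split.
  by apply: (nilpotent_mx_conj chain_mx_unit chain_mx_conj); apply: jordan_mx_nilpotent.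
exists chain_mx; first exact: chain_mx_unit.
by apply: similarW; [rewrite row_free_unit chain_mx_unit | exact: chain_mx_conj].
Qed.

End JordanChains.

(** * Traces in Lie algebras and the Killing form of sl_n *)

Section LieGenerics.
Variables (K : fieldType) (L : lieAlgType K).
Implicit Types x y z : L.

Lemma liebDr x y z : lieb x (y + z) = lieb x y + lieb x z.
Proof. by rewrite -!adE linearD. Qed.

Lemma liebDl x y z : lieb (x + y) z = lieb x z + lieb y z.
Proof. by have := lieb_linearl z 1 x y; rewrite /= !scale1r. Qed.

Lemma liebC x y : lieb x y = - lieb y x.
Proof.
have := liebxx (x + y); rewrite liebDl !liebDr !liebxx add0r addr0.
by move/eqP; rewrite addr_eq0 => /eqP.
Qed.

(** The trace of a sum of rank one maps, free of any choice of basis. The maps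
    ad x \o ad y on sl_n have such a form indexed by the matrix units, though
    not all of these lie in sl_n. *)
Lemma endo_trace_sum (I : finType) (f : 'End(L)) (phi : I -> L -> K) (w : I -> L) :
  (forall a, linear (phi a : L -> K^o)) ->
  (forall v, f v = \sum_a phi a v *: w a) -> endo_trace f = \sum_a phi a (w a).
Proof.
move=> phi_lin fE; rewrite /endo_trace; set b := vbasis _.
transitivity (\sum_a \sum_t coord b t (w a) * phi a b`_t).
  rewrite exchange_big; apply: eq_bigr => t _; rewrite fE linear_sum.
  by apply: eq_bigr => a _; rewrite linearZ /= mulrC.
apply: eq_bigr => a _; pose h := GRing.isLinear.Build K L K^o *:%R (phi a) (phi_lin a).
pose F : {linear L -> K^o} := HB.pack (phi a : L -> K^o) h.
rewrite -[RHS]/(F (w a)) [in RHS](coord_vbasis (memvf (w a))) linear_sum.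
by apply: eq_bigr => t _; rewrite linearZ.
Qed.

End LieGenerics.

Section KillingForm.
Variables (K : fieldType) (n : nat).
Implicit Types (A B : 'M[K]_n) (x y z : sl K n).

(** This is the trace of X |-> A X B on all matrices. *)
Lemma sum_delta_conj A B :
  \sum_(kl : 'I_n * 'I_n) (A *m delta_mx kl.1 kl.2 *m B) kl.1 kl.2 = \tr A * \tr B.
Proof.
rewrite /mxtrace big_distrlr /= pair_bigA /=; apply: eq_bigr => -[k l] _ /=.
rewrite -(mul_delta_mx (0 : 'I_1)) mulmxA -mulmxA -colE -rowE mxE big_ord1.
by rewrite !mxE.
Qed.

Lemma lieb_slE x y : vsval (lieb x y) = vsval x *m vsval y - vsval y *m vsval x.
Proof. exact: sl_liebE. Qed.

(** Expanding [x, [y, E]] on matrix units E gives n tr (xy) twice, and mixed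
    terms tr x tr y, which vanish on sl_n. *)
Lemma killing_sl x y : killing x y = (2 * n)%N%:R * \tr (vsval x *m vsval y).
Proof.
pose X := vsval x; pose Y := vsval y.
(* The traceless image of the matrix unit kl under ad x \o ad y. *)
pose w (kl : 'I_n * 'I_n) : sl K n :=
  lieb x (to_sl (Y *m delta_mx kl.1 kl.2 - delta_mx kl.1 kl.2 *m Y)).
have wE kl : vsval (w kl) =
    X *m (Y *m delta_mx kl.1 kl.2 - delta_mx kl.1 kl.2 *m Y)
    - (Y *m delta_mx kl.1 kl.2 - delta_mx kl.1 kl.2 *m Y) *m X.
  by rewrite lieb_slE vsprojK // tracelessP linearB /= mxtrace_mulC subrr.
rewrite /killing (@endo_trace_sum K (sl K n) _ _ (fun kl (v : sl K n) => vsval v kl.1 kl.2) w).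
- transitivity (\sum_(kl : 'I_n * 'I_n)
    ((X *m Y *m delta_mx kl.1 kl.2 *m 1%:M) kl.1 kl.2
     - (X *m delta_mx kl.1 kl.2 *m Y) kl.1 kl.2
     - (Y *m delta_mx kl.1 kl.2 *m X) kl.1 kl.2
     + (1%:M *m delta_mx kl.1 kl.2 *m (Y *m X)) kl.1 kl.2)).
    apply: eq_bigr => -[k l] _; rewrite wE /= mulmxBr mulmxBl !mulmxA mulmx1 mul1mx.
    by rewrite !mxE; ring.
  rewrite big_split !sumrB !sum_delta_conj !mxtrace1 [\tr (Y *m X)]mxtrace_mulC /=.
  have /eqP -> : \tr X == 0 by rewrite -tracelessP subvsP.
  by rewrite natrM; ring.
- by move=> kl a u v; rewrite sl_valP !mxE.
- move=> v; apply: sl_inj; rewrite comp_lfunE !adE linear_sum /=.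
  under eq_bigr do rewrite wE scalerBr scalemxAr scalemxAl.
  rewrite sumrB -mulmx_sumr -mulmx_suml !lieb_slE.
  have -> : \sum_(kl : 'I_n * 'I_n) vsval v kl.1 kl.2 *:
      (Y *m delta_mx kl.1 kl.2 - delta_mx kl.1 kl.2 *m Y) = Y *m vsval v - vsval v *m Y.
    under eq_bigr do rewrite scalerBr scalemxAr scalemxAl.
    rewrite sumrB -mulmx_sumr -mulmx_suml.
    by rewrite -(pair_bigA _ (fun k l => vsval v k l *: delta_mx k l)) -matrix_sum_delta.
  by [].
Qed.

(** By invariance of the form, as [e, y] = 0. *)
Lemma killing_lieb_comm (e x y : sl K n) : vsval e *m vsval y = vsval y *m vsval e ->
  killing e (lieb x y) = 0.
Proof.
move=> ey; rewrite killing_sl lieb_slE mulmxBr linearB /= [vsval e *m _]mulmxA.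
rewrite [\tr (vsval e *m vsval x *m _)]mxtrace_mulC !mulmxA ey.
by rewrite subrr mulr0.
Qed.

End KillingForm.

(** * The pyramid grading and the subalgebras m1, k and m2 *)

Section Degrees.
Variables (K : fieldType) (n : nat) (mu : seq nat).
Implicit Types (D : pred int) (A B : 'M[K]_n) (x y : sl K n).

(** The degrees are tested on an arbitrary set D because the components that
    occur are sums of graded pieces, such as the degrees at most -2. *)
Definition supp_deg D A := forall k l : 'I_n, A k l != 0 -> D (box_deg mu k l).

Lemma supp_degB D A B : supp_deg D A -> supp_deg D B -> supp_deg D (A - B).
Proof.
move=> DA DB k l; have [/DA //|] := boolP (A k l != 0).
have [/DB //|] := boolP (B k l != 0).
by rewrite !negbK !mxE => /eqP-> /eqP->; rewrite subrr eqxx.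
Qed.

Lemma supp_degM D1 D2 D3 A B : supp_deg D1 A -> supp_deg D2 B ->
  (forall d e, D1 d -> D2 e -> D3 (d + e)) -> supp_deg D3 (A *m B).
Proof.
move=> DA DB D123 k l; apply: contraNT => nD3; rewrite mxE big1 // => s _.
have [->|/DA dA] := eqVneq (A k s) 0; first by rewrite mul0r.
have [->|/DB dB] := eqVneq (B s l) 0; first by rewrite mulr0.
case/negP: nD3; have -> : box_deg mu k l = box_deg mu k s + box_deg mu s l.
  by rewrite /box_deg; ring.
exact: D123.
Qed.

(** The trace form pairs degree d only with degree -d. *)
Lemma supp_deg_trace D1 D2 A B : supp_deg D1 A -> supp_deg D2 B ->
  (forall d, D1 d -> ~~ D2 (- d)) -> \tr (A *m B) = 0.
Proof.
move=> DA DB D12; rewrite /mxtrace big1 // => k _; rewrite mxE big1 // => l _.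
have [->|/DA /D12] := eqVneq (A k l) 0; first by rewrite mul0r.
have -> : - box_deg mu k l = box_deg mu l k by rewrite /box_deg; ring.
by move=> nD; have [->|/DB dB] := eqVneq (B l k) 0; [rewrite mulr0 | rewrite dB in nD].
Qed.

Lemma supp_deg_lieb D1 D2 D3 x y : supp_deg D1 (vsval x) -> supp_deg D2 (vsval y) ->
  (forall d e, D1 d -> D2 e -> D3 (d + e)) -> supp_deg D3 (vsval (lieb x y)).
Proof.
move=> Dx Dy D123; rewrite lieb_slE; apply: supp_degB.
  exact: supp_degM Dx Dy D123.
by apply: supp_degM Dy Dx _ => d e Dd De; rewrite addrC; apply: D123.
Qed.

Lemma pyr_grP d x : reflect (supp_deg (pred1 d) (vsval x)) (x \in pyr_gr K n mu d).
Proof.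
rewrite -memv_preim lfunE /=; apply: (iffP memv_sumP) => [[v vd ->] k l|xd].
  apply: contraR => ne_d; rewrite summxE big1 // => -[s t] /= dst.
  have /vlineP[a ->] := vd (s, t) dst; rewrite !mxE /=.
  case: (k =P s) => [ks|]; last by rewrite mulr0.
  by case: (l =P t) => [lt|]; rewrite ?mulr0 //; rewrite ks lt /= dst in ne_d.
exists (fun kl => vsval x kl.1 kl.2 *: delta_mx kl.1 kl.2).
  by move=> kl _; apply/vlineP; exists (vsval x kl.1 kl.2).
rewrite [LHS]matrix_sum_delta pair_bigA /= [LHS](bigID (fun kl => box_deg mu kl.1 kl.2 == d)) /=.
rewrite [X in _ + X]big1 ?addr0 // => -[k l] /= ne_d.
have [->|/xd] := eqVneq (vsval x k l) 0; first by rewrite scale0r.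
by rewrite /= (negPf ne_d).
Qed.

(** The graded pieces of a matrix of negative degree are again traceless, since
    diagonal entries have degree 0. *)
Lemma pyr_m1P x : reflect (supp_deg (fun d => d <= -2) (vsval x)) (x \in pyr_m1 K n mu).
Proof.
apply: (iffP idP) => [|xm].
  rewrite /pyr_m1; move: x; apply: (big_ind (fun V : {vspace sl K n} =>
    forall x, x \in V -> supp_deg (fun d => d <= -2) (vsval x))).
  - by move=> x; rewrite memv0 => /eqP-> k l; rewrite mxE eqxx.
  - move=> U V IU IV x /memv_addP[u /IU Uu [v /IV Vv ->]].
    rewrite sl_valD -[vsval v]opprK; apply: supp_degB => // k l; rewrite mxE oppr_eq0.
    exact: Vv.
  - by move=> d d_le x /pyr_grP xd k l /xd /eqP->.
pose X d : 'M[K]_n := \matrix_(k, l) if box_deg mu k l == d then vsval x k l else 0.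
have XE d : (d <= -2)%R -> vsval (to_sl (X d)) = X d.
  move=> d_le; apply/vsprojK; rewrite tracelessP /mxtrace big1 // => k _; rewrite mxE.
  by rewrite /box_deg subrr; case: eqP => // d0; rewrite -d0 in d_le.
have -> : x = \sum_(d <- pyr_degrees n mu | (d <= -2)%R) to_sl (X d).
  apply: sl_inj; rewrite linear_sum /=; apply/matrixP => k l; rewrite summxE.
  have [xkl0|xkl] := eqVneq (vsval x k l) 0.
    by rewrite xkl0 big1 // => d d_le; rewrite XE // mxE xkl0; case: ifP.
  rewrite big_mkcond (bigD1_seq (box_deg mu k l)) ?undup_uniq //=.
  - rewrite xm // XE ?xm // mxE eqxx big1 ?addr0 // => d ne_d.
    by case: ifP => // d_le; rewrite XE // mxE eq_sym (negPf ne_d).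
  - by rewrite mem_undup; apply/mapP; exists (k, l); rewrite ?mem_enum.
rewrite big_seq_cond rpred_sum // => d /andP[d_in d_le].
have: to_sl (X d) \in pyr_gr K n mu d.
  by apply/pyr_grP => k l; rewrite XE // mxE /=; case: ifP; rewrite ?eqxx.
apply: subvP; by rewrite /pyr_m1 (big_rem d) //= d_le addvSl.
Qed.

Hypothesis pmu : is_part n mu.
Variables (i j : nat).
Hypothesis lt_ij : (i < j)%N.
Let e1 := pyr_e1 K n mu.
Let e2 := pyr_e2 K n mu i j.
Let m1 := pyr_m1 K n mu.
Let k := pyr_k K n mu i j.
Let m2 := pyr_m2 K n mu i j.
Let chi1 := killing_dual e1.
Let chi2 := killing_dual e2.

Let box_degE (a b : 'I_n) : box_deg mu a b = (2 * (box mu b).2)%N%:Z - (2 * (box mu a).2)%N%:Z.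
Proof. by []. Qed.

Lemma pyr_e1_deg : supp_deg (pred1 2%:Z) (vsval e1).
Proof.
move=> a b; rewrite (pyr_e1_mx pmu) mxE /=; case: (box mu b =P _) => [ab|]; last by rewrite eqxx.
by move=> _; rewrite box_degE ab /=; lia.
Qed.

Lemma pyr_e2_sub_e1_deg : supp_deg (pred1 0) (vsval e2 - vsval e1).
Proof.
move=> a b; rewrite (pyr_e2_mx pmu _ lt_ij) addrC addKr mxE /=.
case: and3P => [[_ _ /eqP ab] _|]; last by rewrite eqxx.
by rewrite box_degE ab subrr.
Qed.

Lemma pyr_k_ind (U : {vspace sl K n}) :
  (forall m, (0 < m)%N -> pyr_E K n mu i j m \in U) -> {subset k <= U}.
Proof.
move=> EU; apply/subvP/span_subvP => _ /mapP[m + ->].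
by rewrite mem_iota => /andP[m_gt0 _]; apply: EU.
Qed.

Lemma pyr_k_deg y : y \in k -> supp_deg (pred1 0) (vsval y).
Proof.
move=> yk; apply/pyr_grP; apply: (pyr_k_ind _ yk) => m m_gt0; apply/pyr_grP => a b.
rewrite (pyr_E_mx pmu) // mxE /=; case: and4P => [[_ _ _ /eqP ab] _|]; last by rewrite eqxx.
by rewrite box_degE ab subrr.
Qed.

Lemma pyr_k_comm_e1 y : y \in k -> lieb e1 y = 0.
Proof.
move=> yk; rewrite -adE; apply/eqP; rewrite -memv_ker.
apply: (pyr_k_ind _ yk) => m m_gt0; rewrite memv_ker adE; apply/eqP/sl_inj.
by rewrite lieb_slE (pyr_E_comm_e1 pmu) // subrr.
Qed.

(** Centralisers are subspaces, so the commutation of the generators extends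
    linearly in one argument after the other. *)
Lemma pyr_k_abelian x y : x \in k -> y \in k -> lieb x y = 0.
Proof.
move=> xk yk; rewrite -adE; apply/eqP; rewrite -memv_ker.
apply: (pyr_k_ind _ yk) => m m_gt0; rewrite memv_ker adE liebC oppr_eq0 -adE -memv_ker.
apply: (pyr_k_ind _ xk) => p p_gt0; rewrite memv_ker adE; apply/eqP/sl_inj.
by rewrite lieb_slE (pyr_E_comm pmu) // subrr.
Qed.

Lemma pyr_m1_lie : lie_subalgebra m1.
Proof.
move=> x y /pyr_m1P xm /pyr_m1P ym; apply/pyr_m1P.
by apply: supp_deg_lieb xm ym _ => d e; lia.
Qed.

Lemma pyr_k_m1_lie : {in k & m1, forall x y, lieb x y \in m1}.
Proof.
move=> x y /pyr_k_deg xk /pyr_m1P ym; apply/pyr_m1P.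
by apply: supp_deg_lieb xk ym _ => d e /= /eqP->; rewrite add0r.
Qed.

Lemma pyr_chi1_k x y : y \in k -> chi1 (lieb x y) = 0.
Proof.
move=> /pyr_k_comm_e1 e1y; rewrite /chi1 killing_dualE killing_lieb_comm //.
have := congr1 vsval e1y; rewrite lieb_slE => /eqP.
by rewrite sl_val0 subr_eq0 => /eqP.
Qed.

Lemma pyr_chi1_m1 : {in m1 &, forall x y, chi1 (lieb x y) = 0}.
Proof.
move=> x y /pyr_m1P xm /pyr_m1P ym; rewrite /chi1 killing_dualE killing_sl.
have xy := @supp_deg_lieb _ _ (fun d => d <= -4) _ _ xm ym.
rewrite (supp_deg_trace pyr_e1_deg (xy _)) ?mulr0 // => [d e|d /= /eqP->]; lia.
Qed.

Lemma pyr_chi21 : {in m1, chi2 =1 chi1}.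
Proof.
move=> x /pyr_m1P xm; rewrite /chi2 /chi1 !killing_dualE !killing_sl.
congr (_ * _); apply/eqP; rewrite -subr_eq0 -linearB /= -mulmxBl.
by rewrite (supp_deg_trace pyr_e2_sub_e1_deg xm) // => d /= /eqP->.
Qed.

(** As k is abelian, a bracket of elements of m2 only involves brackets with at
    least one entry in m1. *)
Lemma pyr_m2_lieb x y : x \in m2 -> y \in m2 ->
  lieb x y \in m1 /\ chi1 (lieb x y) = 0.
Proof.
move=> /memv_addP[x1 x1m [x2 x2k ->]] /memv_addP[y1 y1m [y2 y2k ->]].
rewrite liebDl !liebDr (pyr_k_abelian x2k y2k) addr0.
have m11 := pyr_m1_lie x1m y1m; have m21 := pyr_k_m1_lie x2k y1m.
have m12 : lieb x1 y2 \in m1 by rewrite liebC rpredN; apply: pyr_k_m1_lie.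
split; first by rewrite !rpredD.
rewrite !linearD /= [lieb x2 y1]liebC linearN /= (pyr_chi1_k _ y2k) (pyr_chi1_k _ x2k).
by rewrite pyr_chi1_m1 // oppr0 !addr0.
Qed.

Lemma pyr_m2_lie : lie_subalgebra m2.
Proof.
by move=> x y xm ym; apply: (subvP (addvSl _ _)); case: (pyr_m2_lieb xm ym).
Qed.

Lemma pyr_m2_semidirect : semidirect m2 m1 k.
Proof.
split=> //; first exact: pyr_m1_lie.
- by move=> x y xk yk; rewrite pyr_k_abelian ?mem0v.
- exact: pyr_k_m1_lie.
- apply/eqP; rewrite -subv0; apply/subvP => x /memv_capP[/pyr_m1P xm /pyr_k_deg xk].
  rewrite memv0; apply/eqP/sl_inj; rewrite sl_val0; apply/matrixP => a b; rewrite mxE.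
  by apply/eqP/negPn/negP => nz; have := xm _ _ nz; have /eqP-> := xk _ _ nz.
Qed.

Lemma pyr_chi2_character : restr_character m2 chi2.
Proof. by move=> x y xm ym; have [xy chi_xy] := pyr_m2_lieb xm ym; rewrite pyr_chi21. Qed.

Lemma pyr_k_coad y : y \in k -> coad y chi1 = 0.
Proof.
move=> yk; apply/lfunP => z; rewrite /coad opp_lfunE comp_lfunE adE liebC linearN opprK.
by rewrite [LHS]pyr_chi1_k // zero_lfunE.
Qed.

End Degrees.

(** * Quantum Hamiltonian reduction by stages *)

Section ReductionByStages.
Variables (K : fieldType) (A : pzAlgType K) (m1 k m2 : Type).
Variables (th1 : m1 -> A) (chi1 : m1 -> K) (thk : k -> A) (kappa : k -> K).
Variables (th2 : m2 -> A) (chi2 : m2 -> K) (com : k -> qhr th1 chi1).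
Let J := lideal (shifted th2 chi2).
Hypothesis th1_ideal : forall x, th1 x - scal (chi1 x) \in J.
Hypothesis thk_ideal : forall y, thk y - scal (kappa y) \in J.
Hypothesis th2_split : forall z, exists x y, th2 z = th1 x + thk y.
Hypothesis comE : forall y, qhr_val (com y) = lclass _ (thk y).

Lemma lideal_sub_stage u : u \in lideal (shifted th1 chi1) -> u \in J.
Proof.
move=> /lidealP[r [rS ->]]; rewrite big_seq rpred_sum // => p /rS[x ->].
exact: lidealM.
Qed.

(** The left ideal of the second stage lies in the one-shot ideal J, whichever
    representatives are chosen: a generator of it is represented by a multiple
    of thk y - kappa y, and representatives differ by the ideal of the first
    stage. This is well-definedness of the homomorphism. *)
Lemma stage_ideal d v :
  d \in lideal (shifted com kappa) -> qhr_val d = lclass _ v -> v \in J.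
Proof.
move=> /lidealP[r [rS ->]] dv.
suff [v' Jv' dv'] : exists2 v', v' \in J &
    qhr_val (\sum_(p <- r) p.1 * p.2) = lclass (shifted th1 chi1) v'.
  rewrite -[v](subrK v') rpredD //; apply: lideal_sub_stage.
  by apply/lclass_eq; rewrite -dv -dv'.
rewrite big_seq; elim/big_ind: _ => [|a b [u Ju au] [w Jw bw]|p /rS[y ->]].
- by exists 0; [exact: rpred0 | rewrite raddf0].
- by exists (u + w); [exact: rpredD | rewrite qhr_valD au bw raddfD].
- have [u pu _] := qhrP p.1; exists (u * (thk y - scal (kappa y))).
    by apply: lidealM; apply: thk_ideal.
  by apply: qhr_valM => //; rewrite raddfB -[LHS]/(qhr_val _ - qhr_val _) comE.
Qed.

(** A representative of x is invariant under m1 by the first stage and under k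
    by the second, up to J, and the comoment map of m2 is split by those of
    m1 and k. *)
Lemma stage_lift (x : qhr com kappa) : exists z : qhr th2 chi2,
  forall u (w : qhr th1 chi1), qhr_val w = lclass _ u -> qhr_val x = lclass _ w ->
    qhr_val z = lclass _ u.
Proof.
have [w0 xw0 nw0] := qhrP x; have [u0 wu0 nu0] := qhrP w0.
have inv : lclass (shifted th2 chi2) u0 \in @qhr_invariant K A m2 th2 chi2.
  apply/qhr_invariantP; exists u0 => // z; have [a [b ->]] := th2_split z.
  rewrite mulrDl mulrDr opprD addrACA rpredD //; first exact/lideal_sub_stage/nu0.
  apply: stage_ideal (nw0 b) _; rewrite -[LHS]/(qhr_val _ - qhr_val _) raddfB.
  by rewrite (qhr_valM (comE b) wu0) (qhr_valM wu0 (comE b)).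
exists (QHR inv) => u w wu xw; apply/lclass_eq.
apply: (@stage_ideal (w0 - w)); first by apply/lclass_eq; rewrite -xw0 -xw.
by rewrite -[LHS]/(qhr_val _ - qhr_val _) wu wu0 -raddfB.
Qed.

(** The map on representatives is a homomorphism because both products are
    computed on representatives. *)
Theorem reduction_by_stages : exists Phi : {rmorphism qhr com kappa -> qhr th2 chi2},
  is_alg_hom Phi /\ forall u (w : qhr th1 chi1) (x : qhr com kappa),
    qhr_val w = lclass _ u -> qhr_val x = lclass _ w -> qhr_val (Phi x) = lclass _ u.
Proof.
have [Phi PhiE] := boolp.choice stage_lift.
have reps (x : qhr com kappa) : exists w u, qhr_val x = lclass _ w /\
    qhr_val w = lclass (shifted th1 chi1) u.
  by have [w xw _] := qhrP x; have [u wu _] := qhrP w; exists w, u.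
have Phi_scal a : Phi (scal a) = scal a.
  by apply: qhr_inj; apply: (PhiE _ (scal a) (scal a)).
have Phi_zmod : zmod_morphism Phi.
  move=> x y; have [w [u [xw wu]]] := reps x; have [w' [u' [yw wu']]] := reps y.
  apply: qhr_inj; rewrite -[RHS]/(qhr_val _ - qhr_val _).
  rewrite (PhiE x _ _ wu xw) (PhiE y _ _ wu' yw) -raddfB; apply: (PhiE _ _ (w - w')).
    by rewrite -[LHS]/(qhr_val _ - qhr_val _) wu wu' -raddfB.
  by rewrite -[LHS]/(qhr_val _ - qhr_val _) xw yw -raddfB.
have Phi_monoid : monoid_morphism Phi.
  split=> [|x y].
    by have := Phi_scal 1; have [-> _] := @scal_monoid K (qhr com kappa);
       have [-> _] := @scal_monoid K (qhr th2 chi2).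
  have [w [u [xw wu]]] := reps x; have [w' [u' [yw wu']]] := reps y.
  apply: qhr_inj; rewrite (qhr_valM (PhiE x _ _ wu xw) (PhiE y _ _ wu' yw)).
  by apply: (PhiE _ _ (w * w')); apply: qhr_valM.
pose hz := GRing.isZmodMorphism.Build _ _ Phi Phi_zmod.
pose hm := GRing.isMonoidMorphism.Build _ _ Phi Phi_monoid.
pose F : {rmorphism qhr com kappa -> qhr th2 chi2} := HB.pack Phi hz hm.
by exists F; split=> [a|u w x wu xw]; [apply: Phi_scal | apply: PhiE wu xw].
Qed.

End ReductionByStages.

Section EnvelopingStages.
Variables (K : fieldType) (L : lieAlgType K) (m h k : {vspace L}).
Variables (chi1 chi2 : 'Hom(L, K^o)).
Hypothesis mhk : semidirect m h k.
Hypothesis chi21 : {in h, chi2 =1 chi1}.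

Lemma chi2_split (x : subvs_of h) (y : subvs_of k) :
  chi2 (vsval x + vsval y) = chi1 (vsval x) + restr chi2 y.
Proof. by rewrite linearD /= chi21 ?subvsP. Qed.

Hypothesis chi1_k : forall y, y \in k -> coad y chi1 = 0.

(** The class of y in k is invariant, as [x, y] lies in h for x in h and chi1
    vanishes there: this is where k annihilating chi1 is used. *)
Lemma stage_comomentE (y : subvs_of k) :
  qhr_val (stage_comoment h chi1 y) = lclass _ (uea_in (vsval y)).
Proof.
rewrite /stage_comoment /qhr_of insubdK //; apply/qhr_invariantP.
exists (uea_in (vsval y)) => // x; rewrite -uea_in_lieb.
have [_ _ khh _ _] := mhk.
have xy_h : lieb (vsval x) (vsval y) \in h by rewrite liebC rpredN khh ?subvsP.
have chi_xy : chi1 (lieb (vsval x) (vsval y)) = 0.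
  have /lfunP/(_ (vsval x)) := chi1_k (subvsP y).
  by rewrite /coad opp_lfunE comp_lfunE adE zero_lfunE liebC linearN opprK.
apply: lideal_gen; exists (vsproj h (lieb (vsval x) (vsval y))).
by rewrite /restr vsprojK // chi_xy -[X in scal X](subrr (0 : K)) scal_zmod subrr subr0.
Qed.

Lemma uea_reduction_by_stages :
  exists Phi : {rmorphism stage_red h chi1 (restr chi2 : subvs_of k -> K) -> uea_red m chi2},
    is_alg_hom Phi /\
    forall u (w : uea_red h chi1) (x : stage_red h chi1 (restr chi2 : subvs_of k -> K)),
      qhr_val w = lclass _ u -> qhr_val x = lclass _ w -> qhr_val (Phi x) = lclass _ u.
Proof.
have [_ _ _ hkm _] := mhk.
have gen (x : L) : x \in m -> uea_in x - scal (chi2 x : K) \in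
    lideal (shifted (fun y : subvs_of m => uea_in (vsval y)) (restr chi2)).
  by move=> xm; apply: lideal_gen; exists (vsproj m x); rewrite /restr vsprojK.
apply: (@reduction_by_stages _ _ _ _ _ _ _ (fun y : subvs_of k => uea_in (vsval y))).
- move=> x; rewrite /restr -chi21 ?subvsP //; apply: gen.
  by rewrite -hkm (subvP (addvSl _ _)) ?subvsP.
- by move=> y; apply: gen; rewrite -hkm (subvP (addvSr _ _)) ?subvsP.
- move=> z; have : vsval z \in (h + k)%VS by rewrite hkm subvsP.
  move=> /memv_addP[x xh [y yk ->]].
  by exists (vsproj h x), (vsproj k y); rewrite !vsprojK // uea_inD.
- exact: stage_comomentE.
Qed.

End EnvelopingStages.

Theorem theorem3p9 (R : realType) (n : nat) (la mu : seq nat)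
    (hcov : covers n la mu) :
  (exists i j, box_move la mu i j) /\
  forall i j : nat, box_move la mu i j ->
  let g := sl R[i] n in
  let e1 : g := pyr_e1 R[i] n mu in
  let e2 : g := pyr_e2 R[i] n mu i j in
  let m1 : {vspace g} := pyr_m1 R[i] n mu in
  let k : {vspace g} := pyr_k R[i] n mu i j in
  let m2 : {vspace g} := pyr_m2 R[i] n mu i j in
  let chi1 := killing_dual e1 in
  let chi2 := killing_dual e2 in
  let kappa : subvs_of k -> R[i] := restr chi2 in
  [/\ nilpotent_mx (vsval e2) /\ jordan_type (vsval e2) la,
      lie_subalgebra m2,
      semidirect m2 m1 k,
      [/\ restr_character m2 chi2,
          {in m1, chi2 =1 chi1},
          (forall y : subvs_of k, chi2 (vsval y) = kappa y)
        & forall (x : subvs_of m1) (y : subvs_of k),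
            chi2 (vsval x + vsval y) = chi1 (vsval x) + kappa y]
    & (forall y, y \in k -> coad y chi1 = 0) /\
      [/\ (forall y : subvs_of k,
             qhr_val (stage_comoment m1 chi1 y) = lclass _ (uea_in (vsval y)))
        & exists Phi : {rmorphism stage_red m1 chi1 kappa -> uea_red m2 chi2},
            is_alg_hom Phi /\
            forall (u : uea g) (w : uea_red m1 chi1)
                   (x : stage_red m1 chi1 kappa),
              qhr_val w = lclass _ u -> qhr_val x = lclass _ w ->
              qhr_val (Phi x) = lclass _ u]].
Proof.
split; first exact: covers_box_move hcov.
have [pla pmu _ _ _] := hcov.
move=> i j mv g e1 e2 m1 k m2 chi1 chi2 kappa.
have lt_ij : (i < j)%N by case: mv.
have sd : semidirect m2 m1 k by exact: pyr_m2_semidirect.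
have chi21 : {in m1, chi2 =1 chi1} by exact: pyr_chi21.
have chi1_k : forall y, y \in k -> coad y chi1 = 0 by exact: pyr_k_coad.
split=> //.
- exact: (pyr_e2_jordan_type pmu pla mv (@Num.Theory.pchar_num _)).
- exact: pyr_m2_lie.
- split=> //; first exact: pyr_chi2_character.
  exact: chi2_split chi21.
- split=> //; split; first exact: stage_comomentE sd chi1_k.
  exact: uea_reduction_by_stages sd chi21 chi1_k.
Qed.
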